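(* For every measure $\mu$, the norm in $\mathrm{FBfA}[L_1(\mu)]$ is $\tau$; that is, $\|f\|=\tau_{L_1(\mu)}(f)$ for every $f\in\mathrm{FBfA}[L_1(\mu)]$.
   Context: All spaces are real. A vector lattice algebra is a real associative algebra that is also a vector lattice in which the product of positive elements is positive. An $f$-algebra is a vector lattice algebra such that $a\wedge b=0$ and $c\ge 0$ imply $(ac)\wedge b=0=(ca)\wedge b$. A Banach $f$-algebra is an $f$-algebra equipped with a complete, submultiplicative lattice norm. It is semiprime if $a^2=0$ implies $a=0$. A lattice-algebra homomorphism is a linear map preserving the lattice operations and the product. Contractive means of operator norm at most $1$. The free Banach $f$-algebra generated by a Banach space $E$ is a Banach $f$-algebra $\mathrm{FBfA}[E]$ together with a linear isometric embedding $\eta_E\colon E\to\mathrm{FBfA}[E]$ such that for every Banach $f$-algebra $A$ and every contractive operator $T\colon E\to A$ there exists a unique lattice-algebra homomorphism $\hat T\colon\mathrm{FBfA}[E]\to A$ satisfying $\hat T\circ\eta_E=T$ and $\|\hat T\|=\|T\|$. It exists and is unique up to isometric lattice-algebra isomorphism. For $f\in\mathrm{FBfA}[E]$, $\tau_E(f)$ (or $\tau(f)$) is the least non-negative number such that $\|\hat Tf\|\le\tau_E(f)$ for every semiprime finite-dimensional Banach $f$-algebra $A$ and every contractive operator $T\colon E\to A$. *)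

(* Defs.v *)
From HB Require Import structures.
From mathcomp Require Import all_boot all_order all_algebra.
From mathcomp Require Import all_classical all_reals all_analysis.
From mathcomp Require Import measurable_realfun.

Set Implicit Arguments.
Unset Strict Implicit.
Unset Printing Implicit Defensive.
Import Order.TTheory GRing.Theory Num.Theory.
Import numFieldNormedType.Exports.

Local Open Scope classical_set_scope.
Local Open Scope ring_scope.

(* The order is not taken from Order.Lattice: in the library's hierarchy every
   type that has both an order and a norm is a numeric domain, so no structure
   can inherit both from an order structure and from normedModType. *)
HB.mixin Record isVectorLattice (R : numDomainType) V & GRing.Lmodule R V := {
  vle : rel V;
  vle_refl : reflexive vle;
  vle_anti : antisymmetric vle;
  vle_trans : transitive vle;
  vmeet : V -> V -> V;
  vjoin : V -> V -> V;
  vlexI : forall z x y : V, vle z (vmeet x y) = vle z x && vle z y;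
  vleUx : forall z x y : V, vle (vjoin x y) z = vle x z && vle y z;
  vleD2r : forall z x y : V, vle x y -> vle (x + z) (y + z);
  vscaler_ge0 : forall (a : R) (x : V), 0 <= a -> vle 0 x -> vle 0 (a *: x)
}.

#[short(type="vectorLatticeType")]
HB.structure Definition VectorLattice (R : numDomainType) :=
  {V of GRing.Lmodule R V & isVectorLattice R V}.

(* MathComp rings and algebras are unital, whereas the algebras here need not
   be, so the product is a separate operation. *)
HB.mixin Record isVectorLatticeAlgebra (R : numDomainType) V
    & VectorLattice R V := {
  vmul : V -> V -> V;
  vmulA : associative vmul;
  vmulDl : left_distributive vmul +%R;
  vmulDr : right_distributive vmul +%R;
  vmulZl : forall (a : R) (x y : V), vmul (a *: x) y = a *: vmul x y;
  vmulZr : forall (a : R) (x y : V), vmul x (a *: y) = a *: vmul x y;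
  vmul_ge0 : forall x y : V, vle 0 x -> vle 0 y -> vle 0 (vmul x y)
}.

#[short(type="vectorLatticeAlgType")]
HB.structure Definition VectorLatticeAlgebra (R : numDomainType) :=
  {V of VectorLattice R V & isVectorLatticeAlgebra R V}.

HB.mixin Record isFAlgebra (R : numDomainType) V
    & VectorLatticeAlgebra R V := {
  vmul_disjoint : forall a b c : V, vmeet a b = 0 -> vle 0 c ->
    vmeet (vmul a c) b = 0 /\ vmeet (vmul c a) b = 0
}.

#[short(type="fAlgebraType")]
HB.structure Definition FAlgebra (R : numDomainType) :=
  {V of VectorLatticeAlgebra R V & isFAlgebra R V}.

Definition modulus (R : numDomainType) (V : vectorLatticeType R) (x : V) : V :=
  vjoin x (- x).

HB.mixin Record isBanachFAlgebra (R : realType) V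
    & FAlgebra R V & CompleteNormedModule R V := {
  ler_norm_modulus : forall x y : V,
    vle (modulus x) (modulus y) -> `|x| <= `|y|;
  ler_norm_vmul : forall x y : V, `|vmul x y| <= `|x| * `|y|
}.

#[short(type="banachFAlgType")]
HB.structure Definition BanachFAlgebra (R : realType) :=
  {V of FAlgebra R V & CompleteNormedModule R V & isBanachFAlgebra R V}.

(* L_1(mu) is the quotient of the library's space of measurable functions
   f : T -> R with 'N[mu]_1[f] < +oo by the a.e. null ones.  (The library's
   LspaceType has the right elements, but no vector space structure.) *)
Section L1.
Context d (T : measurableType d) (R : realType).
Variable mu : {measure set T -> \bar R}.

Local Notation Lfun1 := (LfunType mu (@lexx _ _ 1%E)).

Definition ae_null : {pred Lfun1} := fun f => `[< f = cst 0 %[ae mu] >].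

Lemma ae_null_zmod_closed : zmod_closed ae_null.
Proof.
split=> [|f g /asboolP f0 /asboolP g0]; apply/asboolP; first exact: aeW.
apply: filterS2 f0 g0 => x /= fx gx _.
by rewrite [LHS](_ : _ = f x - g x)// fx// gx// subr0.
Qed.

HB.instance Definition _ :=
  GRing.isZmodClosed.Build Lfun1 ae_null ae_null_zmod_closed.

Definition L1 : Type := Quotient.quot ae_null.
HB.instance Definition _ := GRing.Zmodule.on L1.

Definition L1_pi (f : Lfun1) : L1 := (\pi_(Quotient.quot ae_null) f)%qT.
Definition L1_repr (x : L1) : Lfun1 := repr (x : Quotient.quot ae_null).

Lemma L1_reprK (x : L1) : L1_pi (L1_repr x) = x.
Proof. exact: reprK. Qed.

Lemma L1_piP (f g : Lfun1) : L1_pi f = L1_pi g <-> f = g %[ae mu].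
Proof.
rewrite /L1_pi; split.
  move=> /eqP; rewrite -Quotient.idealrBE => /asboolP; apply: filterS => x /= h _.
  by apply: subr0_eq; rewrite -(h I).
move=> fg; apply/eqP; rewrite -Quotient.idealrBE; apply/asboolP.
by apply: filterS fg => x /= h _; rewrite [LHS](_ : _ = f x - g x)// h// subrr.
Qed.

Lemma L1_piK (f : Lfun1) : L1_repr (L1_pi f) = f %[ae mu].
Proof. by apply/L1_piP; rewrite L1_reprK. Qed.

Lemma L1_piD (f g : Lfun1) : L1_pi (f + g) = L1_pi f + L1_pi g.
Proof. by rewrite /L1_pi [LHS]raddfD. Qed.

Definition L1_scale (a : R) (x : L1) : L1 := L1_pi (a *: L1_repr x).

Lemma L1_piZ (a : R) (f : Lfun1) : L1_scale a (L1_pi f) = L1_pi (a *: f).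
Proof.
apply/L1_piP; apply: filterS (L1_piK f) => x /= h _.
by rewrite [LHS](_ : _ = a * L1_repr (L1_pi f) x)// h.
Qed.

Fact L1_scalerA (a b : R) (x : L1) :
  L1_scale a (L1_scale b x) = L1_scale (a * b) x.
Proof. by rewrite -[x]L1_reprK !L1_piZ scalerA. Qed.

Fact L1_scale1r : left_id 1 L1_scale.
Proof. by move=> x; rewrite -[x]L1_reprK L1_piZ scale1r. Qed.

Fact L1_scalerDr : right_distributive L1_scale +%R.
Proof.
by move=> a x y; rewrite -[x]L1_reprK -[y]L1_reprK -L1_piD !L1_piZ -L1_piD scalerDr.
Qed.

Fact L1_scalerDl (x : L1) : {morph L1_scale^~ x : a b / a + b}.
Proof. by move=> a b; rewrite -[x]L1_reprK !L1_piZ -L1_piD scalerDl. Qed.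

HB.instance Definition _ := GRing.Zmodule_isLmodule.Build R L1
  L1_scalerA L1_scale1r L1_scalerDr L1_scalerDl.

Definition L1_norm (x : L1) : R := fine ('N[mu]_1[EFin \o L1_repr x])%E.

Lemma L1_norm_pi (f : Lfun1) : L1_norm (L1_pi f) = fine ('N[mu]_1[EFin \o f])%E.
Proof.
rewrite /L1_norm !Lnorm1; congr fine; apply: ge0_ae_eq_integral => //.
- by apply/measurableT_comp/measurable_EFinP.
- by apply/measurableT_comp/measurable_EFinP.
- by apply: filterS (L1_piK f) => x /= h _; rewrite h.
Qed.

Fact L1_ler_normD (x y : L1) : L1_norm (x + y) <= L1_norm x + L1_norm y.
Proof.
by rewrite -[x]L1_reprK -[y]L1_reprK -L1_piD !L1_norm_pi; exact: ler_LnormD.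
Qed.

Fact L1_normrZ (a : R) (x : L1) : L1_norm (a *: x) = `|a| * L1_norm x.
Proof.
rewrite -[x]L1_reprK -[a *: _]/(L1_scale _ _) L1_piZ !L1_norm_pi.
apply: EFin_inj; rewrite EFinM !finite_norm_fine; exact: LnormZ.
Qed.

Fact L1_normr0_eq0 (x : L1) : L1_norm x = 0 -> x = 0.
Proof.
rewrite -[x]L1_reprK L1_norm_pi => /fine_Lnormr_eq0 h.
suff -> : 0 = L1_pi 0 :> L1 by apply/L1_piP.
by rewrite /L1_pi [RHS]raddf0.
Qed.

HB.instance Definition _ := Lmodule_isNormed.Build R L1
  L1_ler_normD L1_normrZ L1_normr0_eq0.

End L1.

Definition semiprime (R : numDomainType) (A : vectorLatticeAlgType R) :=
  forall a : A, vmul a a = 0 -> a = 0.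

Definition finite_dimensional (R : realType) (V : lmodType R) :=
  exists (n : nat) (f : {linear V -> 'rV[R]_n}), bijective f.

Definition lattice_algebra_hom (R : numDomainType)
    (A B : vectorLatticeAlgType R) (S : A -> B) :=
  [/\ linear S,
      {morph S : x y / vmeet x y},
      {morph S : x y / vjoin x y}
    & {morph S : x y / vmul x y}].

Definition opnorm (R : realType) (E F : normedModType R) (T : E -> F) : \bar R :=
  ereal_sup [set `|T x|%:E | x in [set x : E | `|x| <= 1]].

Definition contractive (R : realType) (E F : normedModType R) (T : E -> F) :=
  (opnorm T <= 1)%E.

Section free_banach_falgebra.
Context (R : realType) (E : normedModType R) (F : banachFAlgType R).
Variable eta : {linear E -> F}.

Definition is_extension (A : banachFAlgType R) (T : E -> A) (S : F -> A) :=
  lattice_algebra_hom S /\ S \o eta = T.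

(* Uniqueness is among all lattice-algebra homomorphisms extending T, not only
   among those of norm ||T||.  For E != 0 this makes no difference, but for
   E = 0 the weaker condition would be satisfied by every Banach f-algebra. *)
Definition is_free_banach_falgebra :=
  (forall x : E, `|eta x| = `|x|) /\
  forall (A : banachFAlgType R) (T : {linear E -> A}), contractive T ->
    (exists! S : F -> A, is_extension T S) /\
    (forall S : F -> A, is_extension T S -> opnorm S = opnorm T).

(* The default value is never used when eta is free and T is contractive. *)
Definition hat (A : banachFAlgType R) (T : E -> A) : F -> A :=
  xget (fun=> 0) [set S | is_extension T S].

Definition tau (f : F) : R :=
  inf [set t : R | 0 <= t /\
    forall A : banachFAlgType R, semiprime A -> finite_dimensional A ->
    forall T : {linear E -> A}, contractive T -> `|hat T f| <= t].

End free_banach_falgebra.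

(* Main.v *)
Require Import Defs.
From HB Require Import structures.
From mathcomp Require Import all_boot all_order all_algebra.
From mathcomp Require Import all_classical all_reals all_analysis.
From mathcomp Require Import measurable_realfun.
From mathcomp Require Import ring lra.
Import Order.TTheory GRing.Theory Num.Theory.
Import numFieldNormedType.Exports.
Local Open Scope classical_set_scope.
Local Open Scope ring_scope.

(** Since the canonical extension of a contraction is a contraction, tau is at
    most the norm, and the content is the converse inequality.

    The lattice-algebraic terms in the elements eta x are dense in the free
    Banach f-algebra F, because the closed sub-f-algebra that they form also has
    the universal property (terms_dense). Let p be such a term. Conditional
    expectations onto finitely many sets of finite measure approximate the
    identity of L_1 on the variables of p by operators x |-> sum_i P_i(x) u_i,
    with |u_i| <= 1 and sum_i |P_i(x)| <= |x| (L1_finite_rank). Composing with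
    such an operator reduces the theorem to a statement about n contractive
    variables, which expresses that l_1^n is the free Banach space on n vectors
    of the unit ball (norm_eval_le): if |p(b)| <= C for all b_1, ..., b_n in the
    unit ball of a semiprime finite-dimensional Banach f-algebra, then
    |p(s)| <= C for all s_1, ..., s_n in the unit ball of any Banach f-algebra.

    To use the hypothesis, take a finite set of nonzero points of the cube
    [-1, 1]^n and, on the algebra of functions on it, the largest
    submultiplicative lattice norm for which the coordinate functions have norm at
    most 1. The norm of p is then the infimum of the sums of the coefficients
    c_w >= 0 for which |p(t)| <= sum_w c_w |t|^w at these points, where w ranges
    over nonempty words. On a smaller cube [-rho, rho]^n long words are
    negligible, up to delta sum_i |t_i|; the coefficients of the short words vary
    in a compact set, and compactness gives one choice of coefficients, with sum at
    most C + delta, that is valid on the whole cube (majorant_exists).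

    It remains to transfer an inequality between terms from the real cube to
    elements s_i of norm less than rho in a Banach f-algebra A (eval_le); applied
    to the above it bounds |p(s)| by C + delta (n + 1). The transfer takes place in
    an ideal of A that contains the s_i, is a subalgebra and has a strong unit e.
    There the lattice homomorphisms phi to the reals separate points
    (lattice_functional_separates) and satisfy phi(xy) = w phi(x) phi(y) with
    w >= 0 (lfun_mul), so that an inequality can be checked in the real line
    with product w x y. For w > 0 this is isomorphic to the usual real line, and
    w = 0, which occurs because A need not be semiprime, is the limit of the
    case w > 0. *)

Set Implicit Arguments.
Unset Strict Implicit.
Unset Printing Implicit Defensive.

(** * Vector lattices and vector lattice algebras *)

Section VectorLattice.
Context {R : realType} {V : vectorLatticeType R}.
Implicit Types (x y z : V) (a : R).

Lemma vlexx x : vle x x. Proof. exact: vle_refl. Qed.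

Lemma vle_eq x y : vle x y -> vle y x -> x = y.
Proof. by move=> xy yx; apply: vle_anti; rewrite xy yx. Qed.

Lemma vleD x y z t : vle x y -> vle z t -> vle (x + z) (y + t).
Proof.
move=> xy zt; apply: (vle_trans (y + z)); first exact: vleD2r.
by rewrite ![y + _]addrC; exact: vleD2r.
Qed.

Lemma vle_add2r z x y : vle (x + z) (y + z) = vle x y.
Proof.
apply/idP/idP => [h|]; last exact: vleD2r.
by have := vleD2r (- z) _ _ h; rewrite !addrK.
Qed.

Lemma subv_ge0 x y : vle 0 (y - x) = vle x y.
Proof. by rewrite -(vle_add2r x) add0r subrK. Qed.

Lemma subv_le0 x y : vle (x - y) 0 = vle x y.
Proof. by rewrite -(vle_add2r y) add0r subrK. Qed.

Lemma vleN2 x y : vle (- x) (- y) = vle y x.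
Proof. by rewrite -subv_ge0 opprK addrC subv_ge0. Qed.

Lemma vaddr_ge0 x y : vle 0 x -> vle 0 y -> vle 0 (x + y).
Proof. by move=> x0 y0; rewrite -[0]addr0; exact: vleD. Qed.

Lemma vsumr_ge0 (I : Type) (r : seq I) (P : pred I) (f : I -> V) :
  (forall i, P i -> vle 0 (f i)) -> vle 0 (\sum_(i <- r | P i) f i).
Proof. by move=> h; apply: (big_ind (vle 0)) => //; [exact: vlexx|exact: vaddr_ge0]. Qed.

Lemma vler_sum1 (I : finType) (f : I -> V) i :
  (forall i, vle 0 (f i)) -> vle (f i) (\sum_j f j).
Proof.
by move=> h; rewrite (bigD1 i)//= -[X in vle X _]addr0 vleD ?vlexx ?vsumr_ge0.
Qed.

Lemma vscaler_le a x y : 0 <= a -> vle x y -> vle (a *: x) (a *: y).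
Proof. by move=> a0 xy; rewrite -subv_ge0 -scalerBr vscaler_ge0// subv_ge0. Qed.

Lemma vscaler_lel a b x : a <= b -> vle 0 x -> vle (a *: x) (b *: x).
Proof. by move=> ab x0; rewrite -subv_ge0 -scalerBl vscaler_ge0// subr_ge0. Qed.

Lemma vhalf_ge0 x : vle 0 (x + x) -> vle 0 x.
Proof.
move=> h; have -> : x = 2^-1 *: (x + x).
  by rewrite -mulr2n -[x *+ 2]scaler_nat scalerA mulVf ?pnatr_eq0// scale1r.
by apply: vscaler_ge0; rewrite ?invr_ge0.
Qed.

Lemma vleUl x y : vle x (vjoin x y).
Proof. by have := vlexx (vjoin x y); rewrite vleUx => /andP[]. Qed.

Lemma vleUr x y : vle y (vjoin x y).
Proof. by have := vlexx (vjoin x y); rewrite vleUx => /andP[]. Qed.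

Lemma vleIl x y : vle (vmeet x y) x.
Proof. by have := vlexx (vmeet x y); rewrite vlexI => /andP[]. Qed.

Lemma vleIr x y : vle (vmeet x y) y.
Proof. by have := vlexx (vmeet x y); rewrite vlexI => /andP[]. Qed.

Lemma vjoin_eqr x y : vle x y -> vjoin x y = y.
Proof. by move=> xy; apply: vle_eq (vleUr _ _); rewrite vleUx xy vlexx. Qed.

Lemma vjoinC x y : vjoin x y = vjoin y x.
Proof. by apply: vle_eq; rewrite vleUx vleUl vleUr. Qed.

Lemma vjoinDr z x y : vjoin (x + z) (y + z) = vjoin x y + z.
Proof.
apply: vle_eq; first by rewrite vleUx !vle_add2r vleUl vleUr.
rewrite -(vle_add2r (- z)) addrK vleUx -[X in vle X _](addrK z) vle_add2r vleUl.
by rewrite -[X in vle X _](addrK z) vle_add2r vleUr.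
Qed.

Lemma vmeet_oppE x y : vmeet x y = - vjoin (- x) (- y).
Proof.
apply: vle_eq.
  by rewrite -vleN2 opprK vleUx !vleN2 vleIl vleIr.
by rewrite vlexI -vleN2 opprK vleUl -vleN2 opprK vleUr.
Qed.

(** The identity x^- = x^+ - x and translation invariance reduce the meet of
    x^+ and x^- to the meet of x and 0 plus x^-. *)
Lemma vpos_disjoint x : vmeet (vjoin x 0) (vjoin (- x) 0) = 0.
Proof.
have e : vjoin (- x) 0 = vjoin x 0 - x.
  by rewrite -vjoinDr subrr add0r vjoinC.
rewrite e vmeet_oppE opprB.
have -> : x - vjoin x 0 = x + - vjoin x 0 by [].
by rewrite -{1}[- vjoin x 0]add0r vjoinDr vjoinC subrr oppr0.
Qed.

Lemma modulus_ge0 x : vle 0 (modulus x).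
Proof.
by apply: vhalf_ge0; rewrite -(subrr x) vleD// ?vleUl ?vleUr.
Qed.

Lemma vle_modulus x : vle x (modulus x). Proof. exact: vleUl. Qed.

Lemma vle_Nmodulus x : vle (- x) (modulus x). Proof. exact: vleUr. Qed.

Lemma modulus_le x y : vle (modulus x) y = vle x y && vle (- x) y.
Proof. exact: vleUx. Qed.

Lemma modulusN x : modulus (- x) = modulus x.
Proof. by rewrite /modulus opprK vjoinC. Qed.

Lemma modulusB x y : modulus (x - y) = modulus (y - x).
Proof. by rewrite -modulusN opprB. Qed.

Lemma ge0_modulus x : vle 0 x -> modulus x = x.
Proof.
move=> x0; apply: vle_eq (vle_modulus _); rewrite modulus_le vlexx/=.
by apply: (vle_trans (0)) => //; rewrite -vleN2 opprK oppr0.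
Qed.

Lemma modulus_idem x : modulus (modulus x) = modulus x.
Proof. exact: ge0_modulus (modulus_ge0 x). Qed.

Lemma modulusD x y : vle (modulus (x + y)) (modulus x + modulus y).
Proof.
by rewrite modulus_le opprD !vleD// ?vle_modulus ?vle_Nmodulus.
Qed.

Lemma modulusZ a x : modulus (a *: x) = `|a| *: modulus x.
Proof.
wlog a0 : a x / 0 < a => [wlg|].
  have [->|] := eqVneq a 0; first by rewrite normr0 !scale0r ge0_modulus ?vlexx.
  rewrite neq_lt => /orP[a0|a0]; last exact: wlg.
  by rewrite -modulusN -scaleNr wlg ?oppr_gt0// normrN.
rewrite gtr0_norm//; apply: vle_eq.
  by rewrite modulus_le -scalerN !vscaler_le ?(ltW a0)// ?vle_modulus ?vle_Nmodulus.
have h : vle (modulus x) (a^-1 *: modulus (a *: x)).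
  rewrite modulus_le -[X in vle X _ && _]scale1r -(mulVf (lt0r_neq0 a0)) -scalerA.
  rewrite -[X in _ && vle (- X) _]scale1r -(mulVf (lt0r_neq0 a0)) -scalerA -scalerN.
  by rewrite !vscaler_le ?invr_ge0 ?(ltW a0)// ?vle_modulus// vle_Nmodulus.
by have := vscaler_le (ltW a0) h; rewrite scalerA mulfV ?lt0r_neq0// scale1r.
Qed.

Lemma vjoin_close x y z t :
  vle (modulus (vjoin x y - vjoin z t)) (modulus (x - z) + modulus (y - t)).
Proof.
have le x' y' z' t' :
    vle (vjoin x' y' - vjoin z' t') (modulus (x' - z') + modulus (y' - t')).
  rewrite -(vle_add2r (vjoin z' t')) subrK vleUx; apply/andP; split.
    rewrite -[X in vle X _](subrK z'); apply: vleD; last exact: vleUl.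
    apply: (vle_trans (modulus (x' - z'))); first exact: vle_modulus.
    by rewrite -[X in vle X _]addr0 vleD ?vlexx ?modulus_ge0.
  rewrite -[X in vle X _](subrK t'); apply: vleD; last exact: vleUr.
  apply: (vle_trans (modulus (y' - t'))); first exact: vle_modulus.
  by rewrite -[X in vle X _]add0r vleD ?vlexx ?modulus_ge0.
by rewrite modulus_le le/= opprB (modulusB x) (modulusB y) le.
Qed.

End VectorLattice.

Section VectorLatticeAlgebra.
Context {R : realType} {V : vectorLatticeAlgType R}.
Implicit Types (x y z : V).

Lemma vmulNl x y : vmul (- x) y = - vmul x y.
Proof. by rewrite -scaleN1r vmulZl scaleN1r. Qed.

Lemma vmulNr x y : vmul x (- y) = - vmul x y.
Proof. by rewrite -scaleN1r vmulZr scaleN1r. Qed.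

Lemma vmulBl x y z : vmul (x - y) z = vmul x z - vmul y z.
Proof. by rewrite vmulDl vmulNl. Qed.

Lemma vmulBr x y z : vmul x (y - z) = vmul x y - vmul x z.
Proof. by rewrite vmulDr vmulNr. Qed.

Lemma vmul_le x y z t : vle 0 x -> vle 0 z -> vle x y -> vle z t ->
  vle (vmul x z) (vmul y t).
Proof.
move=> x0 z0 xy zt; have t0 := vle_trans _ _ _ z0 zt.
apply: (vle_trans (vmul x t)).
  by rewrite -subv_ge0 -vmulBr vmul_ge0// subv_ge0.
by rewrite -subv_ge0 -vmulBl vmul_ge0// subv_ge0.
Qed.

(** Expanding (|x| - x)(|y| + y) + (|x| + x)(|y| - y) >= 0 gives
    2xy <= 2|x||y|, and the other half follows with - x. *)
Lemma modulus_vmul x y : vle (modulus (vmul x y)) (vmul (modulus x) (modulus y)).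
Proof.
have le u : vle (vmul u y) (vmul (modulus u) (modulus y)).
  have p (v : V) : vle 0 (modulus v - v) by rewrite subv_ge0 vle_modulus.
  have q (v : V) : vle 0 (modulus v + v).
    by rewrite -[v in _ + v]opprK subv_ge0 vle_Nmodulus.
  have h := vaddr_ge0 (vmul_ge0 _ _ (p u) (q y)) (vmul_ge0 _ _ (q u) (p y)).
  rewrite -subv_ge0; set A := vmul _ (modulus _).
  apply: vhalf_ge0.
  suff -> : A - vmul u y + (A - vmul u y) =
      vmul (modulus u - u) (modulus y + y) + vmul (modulus u + u) (modulus y - y).
    by [].
  rewrite vmulBl vmulDl !(vmulBr, vmulDr) -/A.
  set B := vmul (modulus u) y; set C := vmul u (modulus y); set D := vmul u y.
  have -> : A + B - (C + D) = (A - D) + (B - C).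
    by rewrite [C + D]addrC opprD addrACA.
  have -> : A - B + (C - D) = (A - D) - (B - C).
    by rewrite opprB [C - D]addrC [C - B]addrC addrACA.
  by rewrite [RHS]addrACA subrr addr0.
by rewrite modulus_le le/= -vmulNl -(modulusN x) le.
Qed.

End VectorLatticeAlgebra.

(** * Sub-f-algebras *)

Section SubFAlgebra.
Context {R : realType} {F : fAlgebraType R}.

Record subfalg_closed (S : set F) : Prop := SubfalgClosed {
  subfalg0 : S 0;
  subfalgD : forall x y, S x -> S y -> S (x + y);
  subfalgZ : forall (a : R) x, S x -> S (a *: x);
  subfalgU : forall x y, S x -> S y -> S (vjoin x y);
  subfalgM : forall x y, S x -> S y -> S (vmul x y) }.

Variables (S : set F) (S_closed : subfalg_closed S).

(** The proof of closedness is an argument of the predicate, hence of the type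
    [subfalg] below, so that the algebraic structures are found by inference. *)
Definition subfalg_pred of subfalg_closed S : {pred F} := [pred x | x \in S].

Fact subfalg_pred_submod : subsemimod_closed (subfalg_pred S_closed).
Proof.
split; last by move=> a x; rewrite !inE => /subfalgZ; exact.
split; first by rewrite inE; exact: subfalg0.
by move=> x y; rewrite !inE; exact: subfalgD.
Qed.

HB.instance Definition _ :=
  GRing.isSubmodClosed.Build R F (subfalg_pred S_closed) subfalg_pred_submod.

Definition subfalg := {x : F | subfalg_pred S_closed x}.
HB.instance Definition _ := SubChoice.on subfalg.
HB.instance Definition _ := [SubChoice_isSubLmodule of subfalg by <:].

Definition subfalg_mk (x : F) (Sx : S x) : subfalg :=
  exist (fun x => subfalg_pred S_closed x) x (mem_set Sx).

Lemma subfalgP (x : subfalg) : S (val x).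
Proof. by have := valP x; rewrite inE. Qed.

Let I_closed x y : S x -> S y -> S (vmeet x y).
Proof.
have N z : S z -> S (- z) by rewrite -scaleN1r; exact: subfalgZ.
by move=> Sx Sy; rewrite vmeet_oppE; apply: (N); apply: subfalgU => //; exact: N.
Qed.

Let sle : rel subfalg := fun x y => vle (val x) (val y).
Let smeet (x y : subfalg) : subfalg :=
  subfalg_mk (I_closed (subfalgP x) (subfalgP y)).
Let sjoin (x y : subfalg) : subfalg :=
  subfalg_mk (subfalgU S_closed (subfalgP x) (subfalgP y)).
Let smul (x y : subfalg) : subfalg :=
  subfalg_mk (subfalgM S_closed (subfalgP x) (subfalgP y)).

Fact sle_refl : reflexive sle. Proof. by move=> x; exact: vle_refl. Qed.
Fact sle_anti : antisymmetric sle.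
Proof. by move=> x y /vle_anti /val_inj. Qed.
Fact sle_trans : transitive sle. Proof. by move=> y x z; exact: vle_trans. Qed.
Fact slexI z x y : sle z (smeet x y) = sle z x && sle z y.
Proof. exact: vlexI. Qed.
Fact sleUx z x y : sle (sjoin x y) z = sle x z && sle y z.
Proof. exact: vleUx. Qed.
Fact sleD2r z x y : sle x y -> sle (x + z) (y + z).
Proof. exact: vleD2r. Qed.
Fact sscaler_ge0 (a : R) x : 0 <= a -> sle 0 x -> sle 0 (a *: x).
Proof. exact: vscaler_ge0. Qed.

HB.instance Definition _ := isVectorLattice.Build R subfalg
  sle_refl sle_anti sle_trans slexI sleUx sleD2r sscaler_ge0.

Fact smulA : associative smul.
Proof. by move=> x y z; apply: val_inj; exact: vmulA. Qed.
Fact smulDl : left_distributive smul +%R.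
Proof. by move=> x y z; apply: val_inj; exact: vmulDl. Qed.
Fact smulDr : right_distributive smul +%R.
Proof. by move=> x y z; apply: val_inj; exact: vmulDr. Qed.
Fact smulZl (a : R) x y : smul (a *: x) y = a *: smul x y.
Proof. by apply: val_inj; exact: vmulZl. Qed.
Fact smulZr (a : R) x y : smul x (a *: y) = a *: smul x y.
Proof. by apply: val_inj; exact: vmulZr. Qed.
Fact smul_ge0 (x y : subfalg) : vle 0 x -> vle 0 y -> vle 0 (smul x y).
Proof. exact: vmul_ge0. Qed.

HB.instance Definition _ := isVectorLatticeAlgebra.Build R subfalg
  smulA smulDl smulDr smulZl smulZr smul_ge0.

Fact smul_disjoint (a b c : subfalg) : vmeet a b = 0 -> vle 0 c ->
  vmeet (vmul a c) b = 0 /\ vmeet (vmul c a) b = 0.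
Proof.
move=> /(congr1 val) ab c0; have [h1 h2] := vmul_disjoint _ _ _ ab c0.
by split; apply: val_inj.
Qed.

HB.instance Definition _ := isFAlgebra.Build R subfalg smul_disjoint.

End SubFAlgebra.

(** * Real characters of Archimedean f-algebras with a strong unit *)

Section Maxlinear.
Context {R : realType} {V : vectorLatticeType R}.
Implicit Types (x y z : V) (p : V -> R).

(** The sublinear functionals that preserve finite suprema. The linear ones
    among them are the real lattice homomorphisms. *)
Record maxlinear p : Prop := Maxlinear {
  maxlinearD : forall x y, p (x + y) <= p x + p y;
  maxlinearZ : forall a x, 0 < a -> p (a *: x) <= a * p x;
  maxlinear_le : forall x y, vle x y -> p x <= p y;
  maxlinearU : forall x y, p (vjoin x y) <= Num.max (p x) (p y) }.

Lemma maxlinear0 p : maxlinear p -> p 0 = 0.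
Proof.
move=> hp; apply/eqP; rewrite eq_le; apply/andP; split.
  have h : (0 : R) < 2^-1 by rewrite invr_gt0.
  by have := maxlinearZ hp 0 h; rewrite scaler0; lra.
by have := maxlinearD hp 0 0; rewrite addr0; lra.
Qed.

Lemma maxlinear_geN p x : maxlinear p -> - p (- x) <= p x.
Proof.
by move=> hp; have := maxlinearD hp x (- x); rewrite subrr (maxlinear0 hp); lra.
Qed.

(** An infimum of max-preserving sublinear functionals has the same properties
    provided that the infimum is taken over a family directed downwards; the
    directedness is stated operation by operation so that the lemma also covers
    families whose members are not themselves sublinear. *)
Lemma maxlinear_inf (I : Type) (D : set I) (v : I -> V -> R) (b : V -> R) :
  (exists i, D i) ->
  (forall i x, D i -> b x <= v i x) ->
  (forall i j, D i -> D j -> exists2 k, D k &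
    forall x y, v k (x + y) <= v i x + v j y) ->
  (forall i a, D i -> 0 < a -> exists2 k, D k &
    forall x, v k (a *: x) <= a * v i x) ->
  (forall i x y, D i -> vle x y -> v i x <= v i y) ->
  (forall i j, D i -> D j -> exists2 k, D k &
    forall x y, v k (vjoin x y) <= Num.max (v i x) (v j y)) ->
  let q x := inf [set v i x | i in D] in
  maxlinear q /\ forall i x, D i -> q x <= v i x.
Proof.
move=> [i0 Di0] lb vD vZ vmono vU q.
have has_lb x : has_lbound [set v i x | i in D].
  by exists (b x) => _ [i Di <-]; exact: lb.
have ne x : [set v i x | i in D] !=set0 by exists (v i0 x), i0.
have q_le i x : D i -> q x <= v i x.
  by move=> Di; apply: ge_inf => //; exists i.
have le_q c x : (forall i, D i -> c <= v i x) -> c <= q x.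
  move=> h; apply: lb_le_inf; first exact: ne.
  by move=> _ [i Di <-]; exact: h.
split=> //; split.
- move=> x y; rewrite -lerBlDr; apply: (le_q) => i Di.
  rewrite lerBlDr -lerBlDl; apply: (le_q) => j Dj.
  have [k Dk h] := vD _ _ Di Dj; rewrite lerBlDl.
  exact: le_trans (q_le _ _ Dk) (h _ _).
- move=> a x a0; rewrite -ler_pdivrMl//; apply: (le_q) => i Di.
  have [k Dk h] := vZ _ _ Di a0; rewrite ler_pdivrMl//.
  exact: le_trans (q_le _ _ Dk) (h _).
- move=> x y xy; apply: (le_q) => i Di.
  exact: le_trans (q_le _ _ Di) (vmono _ _ _ Di xy).
- move=> x y; rewrite leNgt; apply/negP; rewrite gt_max => /andP[].
  move=> /(inf_lt (ne x))[_ [i Di <-] hi] /(inf_lt (ne y))[_ [j Dj <-] hj].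
  have [k Dk h] := vU _ _ Di Dj.
  have := le_lt_trans (le_trans (q_le _ _ Dk) (h x y)) _.
  by move=> /(_ (q (vjoin x y))); rewrite gt_max hi hj ltxx => /(_ isT).
Qed.

(** The tilt of p in the direction y is the largest sublinear minorant of p
    that is additive along y; it is what makes minimal functionals linear. *)
Lemma maxlinear_tilt p y : maxlinear p ->
  exists q, [/\ maxlinear q, forall x, q x <= p x & q (- y) <= - p y].
Proof.
move=> hp; pose v t x := p (x + t *: y) - t * p y.
have pt t x z : 0 <= t -> p (z + t *: y) <= p z + t * p y.
  rewrite le_eqVlt => /predU1P[<-|t0]; first by rewrite scale0r mul0r !addr0.
  by apply: le_trans (maxlinearD hp _ _) _; rewrite lerD2l maxlinearZ.
have vD t s x z : v (t + s) (x + z) <= v t x + v s z.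
  rewrite /v scalerDl addrACA; have := maxlinearD hp (x + t *: y) (z + s *: y).
  by lra.
have v_anti t s x : 0 <= s -> v (t + s) x <= v t x.
  move=> s0; rewrite /v scalerDl addrA; have := pt s 0 (x + t *: y) s0; lra.
have [] := @maxlinear_inf R [set t | 0 <= t] v (fun x => - p (- x)).
- by exists 0 => /=.
- move=> t x /= t0; rewrite /v.
  have h : t * p y <= p (t *: y).
    move: t0; rewrite le_eqVlt => /predU1P[<-|t0].
      by rewrite scale0r mul0r (maxlinear0 hp).
    rewrite -ler_pdivlMl//; apply: le_trans (maxlinearZ hp _ _); rewrite ?invr_gt0//.
    by rewrite scalerA mulVf ?scale1r// gt_eqF.
  have := maxlinearD hp (x + t *: y) (- x); rewrite addrAC subrr add0r; lra.
- by move=> t s /= t0 s0; exists (t + s) => //=; rewrite addr_ge0.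
- move=> t a /= t0 a0; exists (a * t) => /=; first by rewrite mulr_ge0// ltW.
  move=> x; rewrite /v -scalerA -scalerDr mulrBr mulrA lerD2r.
  exact: maxlinearZ.
- move=> t x z _ xz; rewrite /v lerD2r; apply: (maxlinear_le hp).
  by rewrite vle_add2r.
- move=> t s /= t0 s0; exists (t + s) => /=; first exact: addr_ge0.
  move=> x z; have : v (t + s) (vjoin x z) <= Num.max (v (t + s) x) (v (t + s) z).
    rewrite {1}/v -vjoinDr lerBlDr; apply: le_trans (maxlinearU hp _ _) _.
    by rewrite ge_max -!lerBlDr !le_max !lexx orbT.
  move=> /le_trans; apply; rewrite ge_max !le_max v_anti//= addrC v_anti//.
  by rewrite orbT.
move=> q_ok q_le; exists (fun x => inf [set v i x | i in [set t | 0 <= t]]).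
split=> // [x|].
  by apply: le_trans (q_le 0 x _) _ => //=; rewrite /v scale0r mul0r subr0 addr0.
apply: le_trans (q_le 1 _ _) _ => //=.
by rewrite /v scale1r addNr (maxlinear0 hp) mul1r sub0r.
Qed.

(** Zorn's lemma produces a minimal functional below p; being equal to all of
    its tilts it is additive along every direction, hence linear. *)
Lemma maxlinear_minimal p : maxlinear p ->
  exists q, [/\ maxlinear q, forall x, q x <= p x & forall x, q (- x) = - q x].
Proof.
move=> hp; pose T := {q : V -> R | maxlinear q /\ forall x, q x <= p x}.
pose le : rel T := fun q r => `[< forall x, sval r x <= sval q x >].
have [] := @Zorn T le.
- by move=> q; apply/asboolP.
- move=> q r s /asboolP qr /asboolP rs; apply/asboolP => x.
  exact: le_trans (rs x) (qr x).
- move=> [q hq] [r hr] /asboolP/= qr /asboolP/= rq; apply: eq_exist => /=.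
  by apply/funext => x; apply/eqP; rewrite eq_le qr rq.
- move=> A Atot; have [[q0 Aq0]|A0] := pselect (exists q, A q); last first.
    by exists (exist _ p (conj hp (fun=> lexx _))) => q Aq; case: A0; exists q.
  have dir q r : A q -> A r -> exists2 s, A s &
      (forall x, sval s x <= sval q x) /\ (forall x, sval s x <= sval r x).
    move=> Aq Ar; have [/asboolP qr|/asboolP rq] := Atot _ _ Aq Ar.
      by exists r.
    by exists q.
  have [] := @maxlinear_inf T A sval (fun x => - p (- x)).
  + by exists q0.
  + move=> [q [hq qp]] x _ /=; apply: le_trans (maxlinear_geN x hq).
    by rewrite lerN2.
  + move=> q r Aq Ar; have [s As [sq sr]] := dir _ _ Aq Ar; exists s => // x y.
    by apply: le_trans (maxlinearD (svalP s).1 _ _) _; rewrite lerD.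
  + by move=> q a Aq a0; exists q => // x; exact: (maxlinearZ (svalP q).1).
  + by move=> q x y Aq; exact: (maxlinear_le (svalP q).1).
  + move=> q r Aq Ar; have [s As [sq sr]] := dir _ _ Aq Ar; exists s => // x y.
    apply: le_trans (maxlinearU (svalP s).1 _ _) _.
    by rewrite ge_max !le_max sq sr orbT.
  move=> q_ok q_le.
  have qp x : inf [set sval q x | q in A] <= p x.
    exact: le_trans (q_le _ x Aq0) ((svalP q0).2 x).
  exists (exist (fun q => maxlinear q /\ forall x, q x <= p x) _ (conj q_ok qp)).
  move=> r Ar; apply/asboolP => x /=.
  exact: q_le.
move=> [q [hq qp]] qmin; exists q; split=> // y.
have [r [hr rq ry]] := maxlinear_tilt y hq.
have rp x : r x <= p x by exact: le_trans (rq x) (qp x).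
apply/eqP; rewrite eq_le; apply/andP; split; last first.
  by rewrite lerNl; exact: maxlinear_geN.
have /(congr1 sval)/= rqE : exist _ r (conj hr rp) = exist _ q (conj hq qp) :> T.
  by apply: qmin; apply/asboolP.
by move: ry; rewrite rqE.
Qed.

End Maxlinear.

Section Character.
Context {R : realType} {V : vectorLatticeType R}.
Implicit Types (x y : V).

Record lattice_functional (phi : V -> R) : Prop := LatticeFunctional {
  lfunD : forall x y, phi (x + y) = phi x + phi y;
  lfunZ : forall a x, phi (a *: x) = a * phi x;
  lfunU : forall x y, phi (vjoin x y) = Num.max (phi x) (phi y) }.

Variable e : V.
Hypothesis e_ge0 : vle 0 e.
Hypothesis e_unit : forall x, exists r, vle x (r *: e).
Hypothesis archimedean :
  forall x y, (forall eps : R, 0 < eps -> vle x (eps *: y)) -> vle x 0.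

Let e_pos x r : ~~ vle x 0 -> vle 0 (r *: e) -> 0 <= r.
Proof.
move=> x_nle0; apply: contraTT; rewrite -ltNge => r0; apply: contra x_nle0 => re.
have e0 : e = 0.
  apply: vle_eq e_ge0; have := vscaler_le (_ : 0 <= - r^-1) re.
  rewrite scaler0 scalerA mulNr mulVf ?ltr0_neq0// scaleN1r -vleN2 opprK oppr0.
  by apply; rewrite oppr_ge0 invr_le0 ltW.
by have [s] := e_unit x; rewrite e0 scaler0.
Qed.

(** The gauge g : y |-> min {r | y <= r e} is sublinear and max-preserving, and
    the Archimedean property gives g x > 0. The tilt of g towards x takes a value
    at most - g x at - x, so a linear functional below it is at least g x at x. *)
Lemma lattice_functional_separates x : ~~ vle x 0 ->
  exists2 phi, lattice_functional phi & 0 < phi x.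
Proof.
move=> x_nle0; have e0 := e_pos x_nle0.
pose g y := inf [set r | vle y (r *: e)].
have g_lb y : has_lbound [set r | vle y (r *: e)].
  have [s ys] := e_unit (- y); exists (- s) => r /= yr.
  rewrite -subr_ge0 opprK; apply: e0.
  by rewrite scalerDl -(subrr y) vleD.
have g_min y : vle y (g y *: e).
  rewrite -subv_le0; apply: (@archimedean _ e) => eps eps0.
  rewrite -(vle_add2r (g y *: e)) subrK -scalerDl.
  have [] := inf_adherent eps0 (_ : has_inf [set r | vle y (r *: e)]).
    by split => //; have [r] := e_unit y; exists r.
  move=> r /= yr rlt; apply: vle_trans yr _; apply: vscaler_lel e_ge0.
  by rewrite addrC ltW.
have g_le y r : vle y (r *: e) -> g y <= r by move=> yr; apply: ge_inf.
have hg : maxlinear g.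
  split.
  - by move=> y z; apply: (g_le); rewrite scalerDl vleD.
  - by move=> a y a0; apply: (g_le); rewrite -scalerA vscaler_le// ltW.
  - by move=> y z yz; apply: (g_le); exact: vle_trans yz _.
  - move=> y z; apply: (g_le); rewrite vleUx.
    apply/andP; split; apply: vle_trans (g_min _) _; apply: vscaler_lel => //;
      by rewrite le_max lexx ?orbT.
have [p [hp pg px]] := maxlinear_tilt x hg.
have [q [hq qp qN]] := maxlinear_minimal hp.
exists q; last first.
  apply: (@lt_le_trans _ _ (g x)); last first.
    by rewrite -lerN2 -qN; exact: le_trans (qp _) px.
  rewrite ltNge; apply: contra x_nle0 => gx; apply: vle_trans (g_min x) _.
  by rewrite -[X in vle _ X](scale0r e); exact: vscaler_lel.
have qD y z : q (y + z) = q y + q z.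
  apply/eqP; rewrite eq_le (maxlinearD hq)/=.
  by have := maxlinearD hq (y + z) (- z); rewrite addrK qN; lra.
have qZ a y : 0 < a -> q (a *: y) = a * q y.
  move=> a0; apply/eqP; rewrite eq_le (maxlinearZ hq)//= -ler_pdivlMl//.
  have := maxlinearZ hq (a *: y) (_ : 0 < a^-1).
  by rewrite invr_gt0 scalerA mulVf ?gt_eqF// scale1r => ->.
split=> //.
  move=> a y; have [a0|a0|->] := ltgtP a 0.
  - by rewrite -[in LHS](opprK a) scaleNr qN qZ ?oppr_gt0// mulNr opprK.
  - exact: qZ.
  - by rewrite scale0r mul0r (maxlinear0 hq).
move=> y z; apply/eqP; rewrite eq_le (maxlinearU hq)/= ge_max.
by rewrite !(maxlinear_le hq) ?vleUl ?vleUr.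
Qed.

End Character.

Section CharacterMul.
Context {R : realType} {U : fAlgebraType R}.
Variable phi : U -> R.
Hypothesis hphi : lattice_functional phi.
Implicit Types (x y : U).

Lemma lfun0 : phi 0 = 0.
Proof. by have := lfunZ hphi 0 0; rewrite scale0r mul0r. Qed.

Lemma lfunN x : phi (- x) = - phi x.
Proof. by rewrite -scaleN1r (lfunZ hphi) mulN1r. Qed.

Lemma lfun_le x y : vle x y -> phi x <= phi y.
Proof. by move=> /vjoin_eqr <-; rewrite (lfunU hphi) le_max lexx. Qed.

Lemma lfun_ge0 x : vle 0 x -> 0 <= phi x.
Proof. by move=> /lfun_le; rewrite lfun0. Qed.

Lemma lfun_modulus x : phi (modulus x) = `|phi x|.
Proof.
rewrite (lfunU hphi) lfunN; have [h|h] := leP 0 (phi x).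
  by rewrite ger0_norm// max_l// (le_trans _ h)// oppr_le0.
by rewrite ltr0_norm// max_r// (le_trans (ltW h))// oppr_ge0 ltW.
Qed.

Lemma lfun_meet x y : phi (vmeet x y) = Num.min (phi x) (phi y).
Proof. by rewrite vmeet_oppE lfunN (lfunU hphi) !lfunN oppr_max !opprK. Qed.

(** The kernel is an ideal: if phi x = 0 and x >= 0, the part (x - eps e)^+ is
    disjoint from (x - eps e)^-, on which phi is positive, and stays so after
    a multiplication. *)
Lemma lfun_mul_ker e x y : 0 < phi e -> phi x = 0 ->
  phi (vmul x y) = 0 /\ phi (vmul y x) = 0.
Proof.
move=> e0.
wlog [x0 y0] : x y / vle 0 x /\ vle 0 y => [wlg phix|phix].
  have := wlg (modulus x) (modulus y) (conj (modulus_ge0 _) (modulus_ge0 _)).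
  rewrite lfun_modulus phix normr0 => /(_ erefl)[xy yx].
  split; apply/eqP; rewrite -normr_eq0 -lfun_modulus eq_le.
    by rewrite -{1}xy lfun_le ?modulus_vmul//= lfun_ge0// modulus_ge0.
  by rewrite -{1}yx lfun_le ?modulus_vmul//= lfun_ge0// modulus_ge0.
have small eps : 0 < eps ->
    phi (vmul x y) <= eps * phi (vmul e y) /\ phi (vmul y x) <= eps * phi (vmul y e).
  move=> eps0; set u := x - eps *: e.
  have up : vle 0 (vjoin u 0) by exact: vleUr.
  have phiu : phi (vjoin (- u) 0) = eps * phi e.
    rewrite (lfunU hphi) lfun0 lfunN (lfunD hphi) lfunN (lfunZ hphi) phix.
    by rewrite sub0r opprK max_l// mulr_ge0// ltW.
  have [h1 h2] := vmul_disjoint _ _ _ (vpos_disjoint u) y0.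
  have zero z : vle 0 z -> vmeet z (vjoin (- u) 0) = 0 -> phi z = 0.
    move=> z0 /(congr1 phi); rewrite lfun_meet lfun0 phiu.
    by case: leP => // _ /eqP; rewrite mulf_eq0 !gt_eqF.
  have xle : vle x (vjoin u 0 + eps *: e).
    by rewrite -[X in vle X _](subrK (eps *: e)) vle_add2r vleUl.
  split.
    have := lfun_le (vmul_le x0 y0 xle (vlexx y)).
    by rewrite vmulDl vmulZl (lfunD hphi) (lfunZ hphi) (zero _ _ h1) ?add0r// vmul_ge0.
  have := lfun_le (vmul_le y0 x0 (vlexx y) xle).
  by rewrite vmulDr vmulZr (lfunD hphi) (lfunZ hphi) (zero _ _ h2) ?add0r// vmul_ge0.
have le0 (a b : R) : (forall eps, 0 < eps -> a <= eps * b) -> a <= 0.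
  move=> h; rewrite leNgt; apply/negP => a0.
  have b0 : 0 < b by have := h 1 ltr01; lra.
  have p : 0 < a / (2 * b) by rewrite divr_gt0// mulr_gt0.
  have := h _ p; have -> : a / (2 * b) * b = a / 2 by field; rewrite gt_eqF.
  lra.
split; apply/eqP; rewrite eq_le lfun_ge0 ?vmul_ge0// andbT; apply: (le0) => eps /small[];
 by [move=> h _; exact: h|move=> _ h; exact: h].
Qed.

(** Modulo the kernel, which is an ideal by the previous lemma, every element is
    a multiple of e. The resulting factor is zero exactly when phi (e^2) = 0:
    products may be invisible to phi when the algebra is not semiprime. *)
Lemma lfun_mul e x y : 0 < phi e ->
  phi (vmul x y) = phi (vmul e e) / phi e ^+ 2 * phi x * phi y.
Proof.
move=> e0.
have ker z : phi (z - (phi z / phi e) *: e) = 0.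
  by rewrite (lfunD hphi) lfunN (lfunZ hphi) divfK ?gt_eqF// subrr.
have [+ _] := lfun_mul_ker y e0 (ker x); have [_] := lfun_mul_ker e e0 (ker y).
rewrite vmulBl vmulBr vmulZl vmulZr !(lfunD hphi) !lfunN !(lfunZ hphi).
move=> /subr0_eq ey /subr0_eq ->; rewrite ey; field.
by rewrite gt_eqF.
Qed.

End CharacterMul.

(** * Lattice-algebraic terms *)

Inductive term (R X : Type) : Type :=
| TVar of X
| TZero
| TAdd of term R X & term R X
| TScale of R & term R X
| TMul of term R X & term R X
| TJoin of term R X & term R X.
Arguments TVar {R X}.
Arguments TZero {R X}.

Fixpoint vars (R X : Type) (p : term R X) : seq X :=
  match p with
  | TVar x => [:: x]
  | TZero => [::]
  | TScale _ p => vars p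
  | TAdd p q | TMul p q | TJoin p q => vars p ++ vars q
  end.

Fixpoint tsubst (R X Y : Type) (f : X -> term R Y) (p : term R X) : term R Y :=
  match p with
  | TVar x => f x
  | TZero => TZero
  | TAdd p q => TAdd (tsubst f p) (tsubst f q)
  | TScale a p => TScale a (tsubst f p)
  | TMul p q => TMul (tsubst f p) (tsubst f q)
  | TJoin p q => TJoin (tsubst f p) (tsubst f q)
  end.

Section Eval.
Context {R : realType} {X : Type}.
Implicit Types (p q : term R X).

Fixpoint eval (V : vectorLatticeAlgType R) (b : X -> V) (p : term R X) : V :=
  match p with
  | TVar x => b x
  | TZero => 0
  | TAdd p q => eval b p + eval b q
  | TScale a p => a *: eval b p
  | TMul p q => vmul (eval b p) (eval b q)
  | TJoin p q => vjoin (eval b p) (eval b q)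
  end.

(** The value of a term in the f-algebra of real numbers with the product
    (x, y) |-> w x y, for w >= 0. *)
Fixpoint reval (w : R) (t : X -> R) p : R :=
  match p with
  | TVar x => t x
  | TZero => 0
  | TAdd p q => reval w t p + reval w t q
  | TScale a p => a * reval w t p
  | TMul p q => w * reval w t p * reval w t q
  | TJoin p q => Num.max (reval w t p) (reval w t q)
  end.

Lemma hom_eval (V W : vectorLatticeAlgType R) (S : V -> W) (b : X -> V) p :
  lattice_algebra_hom S -> S (eval b p) = eval (S \o b) p.
Proof.
case=> lin _ hU hM.
have hD x y : S (x + y) = S x + S y by have := lin 1 x y; rewrite !scale1r.
have h0 : S 0 = 0 by apply: (addIr (S 0)); rewrite -hD !add0r.
have hZ a x : S (a *: x) = a *: S x by have := lin a x 0; rewrite h0 !addr0.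
by elim: p => [x||p IHp q IHq|a p IHp|p IHp q IHq|p IHp q IHq] //=;
  rewrite ?(hD, hZ, hU, hM) ?IHp ?IHq.
Qed.

Lemma lfun_eval (V : vectorLatticeAlgType R) (phi : V -> R) w (b : X -> V) p :
  lattice_functional phi ->
  (forall x y, phi (vmul x y) = w * phi x * phi y) ->
  phi (eval b p) = reval w (phi \o b) p.
Proof.
move=> hphi hM.
elim: p => [x||p IHp q IHq|a p IHp|p IHp q IHq|p IHp q IHq] //=.
- by have := lfunZ hphi 0 0; rewrite scale0r mul0r.
- by rewrite (lfunD hphi) IHp IHq.
- by rewrite (lfunZ hphi) IHp.
- by rewrite hM IHp IHq.
- by rewrite (lfunU hphi) IHp IHq.
Qed.

(** For w > 0 multiplication by w is an isomorphism onto the usual real line. *)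
Lemma reval_rescale w (t : X -> R) p : 0 <= w ->
  w * reval w t p = reval 1 (fun x => w * t x) p.
Proof.
move=> w0; elim: p => [x||p IHp q IHq|a p IHp|p IHp q IHq|p IHp q IHq] //=.
- by rewrite mulr0.
- by rewrite mulrDr IHp IHq.
- by rewrite mulrCA IHp.
- by rewrite -IHp -IHq; ring.
- by rewrite maxr_pMr// IHp IHq.
Qed.

Lemma reval_continuous (t : X -> R) p : continuous (fun w => reval w t p).
Proof.
elim: p => [x||p IHp q IHq|a p IHp|p IHp q IHq|p IHp q IHq] w /=.
- exact: cvg_cst.
- exact: cvg_cst.
- by apply: cvgD; [exact: IHp|exact: IHq].
- by apply: cvgM; [exact: cvg_cst|exact: IHp].
- by apply: cvgM; [apply: cvgM; [exact: cvg_id|exact: IHp]|exact: IHq].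
- rewrite (_ : (fun x => _) = fun x => 2^-1 * (reval x t p + reval x t q +
    `|reval x t p - reval x t q|)); last first.
    by apply/funext => x; rewrite maxr_absE mulrC.
  apply: cvgM; first exact: cvg_cst.
  apply: cvgD; first by apply: cvgD; [exact: IHp|exact: IHq].
  by apply: cvg_norm; apply: cvgB; [exact: IHp|exact: IHq].
Qed.

Lemma eq_eval (V : vectorLatticeAlgType R) (b c : X -> V) p :
  b =1 c -> eval b p = eval c p.
Proof. by move=> /funext ->. Qed.

End Eval.

Lemma eval_subst (R : realType) (X Y : Type) (V : vectorLatticeAlgType R) (b : X -> V)
    (f : Y -> term R X) (p : term R Y) :
  eval b (tsubst f p) = eval (fun y => eval b (f y)) p.
Proof.
by elim: p => [x||p IHp q IHq|a p IHp|p IHp q IHq|p IHp q IHq] //=;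
  rewrite ?IHp ?IHq.
Qed.

Section Sums.
Context {R : realType} {X : Type} {J : Type}.

Definition tsum (r : seq J) (f : J -> term R X) : term R X :=
  foldr (fun j => TAdd (f j)) TZero r.

Lemma eval_sum (V : vectorLatticeAlgType R) (b : X -> V) r f :
  eval b (tsum r f) = \sum_(j <- r) eval b (f j).
Proof. by elim: r => [|j r IHr] /=; rewrite ?big_nil ?big_cons ?IHr. Qed.

Lemma reval_sum w (t : X -> R) r f :
  reval w t (tsum r f) = \sum_(j <- r) reval w t (f j).
Proof. by elim: r => [|j r IHr] /=; rewrite ?big_nil ?big_cons ?IHr. Qed.

End Sums.

(** * Norm and order in a Banach f-algebra *)

Section BanachFAlgebra.
Context {R : realType} {A : banachFAlgType R}.
Implicit Types (x y z : A).

Lemma norm_modulus x : `|modulus x| = `|x|.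
Proof.
by apply/eqP; rewrite eq_le !ler_norm_modulus// modulus_idem vlexx.
Qed.

Lemma vle_norm x y : vle 0 x -> vle x y -> `|x| <= `|y|.
Proof.
by move=> x0 xy; apply: ler_norm_modulus; rewrite !ge0_modulus// (vle_trans _ _ _ x0).
Qed.

Lemma norm_le_of_modulus x y : vle (modulus x) y -> `|x| <= `|y|.
Proof. by move=> xy; rewrite -norm_modulus vle_norm// modulus_ge0. Qed.

Lemma norm_vjoinB x y z t : `|vjoin x y - vjoin z t| <= `|x - z| + `|y - t|.
Proof.
apply: le_trans (norm_le_of_modulus (vjoin_close x y z t)) _.
by apply: le_trans (ler_normD _ _) _; rewrite !norm_modulus.
Qed.

Lemma norm_vmulB x y z t :
  `|vmul x y - vmul z t| <= `|x - z| * `|y| + `|z| * `|y - t|.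
Proof.
have -> : vmul x y - vmul z t = vmul (x - z) y + vmul z (y - t).
  by rewrite vmulBl vmulBr addrA subrK.
by apply: le_trans (ler_normD _ _) _; rewrite lerD// ler_norm_vmul.
Qed.

(** A lattice norm is monotone: if x <= eps y then |x^+| <= eps |y|. *)
Lemma banach_archimedean x y :
  (forall eps : R, 0 < eps -> vle x (eps *: y)) -> vle x 0.
Proof.
move=> h; suff: `|vjoin x 0| = 0.
  by move=> /normr0_eq0 x0; rewrite -x0; exact: vleUl.
apply/eqP; rewrite eq_le normr_ge0 andbT.
have le eps : 0 < eps -> `|vjoin x 0| <= eps * `|y|.
  move=> eps0; rewrite -(gtr0_norm eps0) -normrZ -[leRHS]norm_modulus.
  apply: vle_norm; first exact: vleUr.
  rewrite vleUx modulus_ge0 andbT; apply: vle_trans (h _ eps0) _.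
  exact: vle_modulus.
rewrite leNgt; apply/negP => x0.
have y0 : 0 < `|y| by have := le 1 ltr01; lra.
have p : 0 < `|vjoin x 0| / (2 * `|y|) by rewrite divr_gt0// mulr_gt0.
have := le _ p; have -> : `|vjoin x 0| / (2 * `|y|) * `|y| = `|vjoin x 0| / 2.
  by field; rewrite gt_eqF.
lra.
Qed.

Lemma closed_nonneg : closed [set x : A | vle 0 x].
Proof.
have -> : [set x : A | vle 0 x] = (fun x : A => `|vjoin (- x) 0|) @^-1` [set r | r <= 0].
  apply/seteqP; split => x /=; rewrite normr_le0.
    by move=> x0; rewrite vjoin_eqr// -vleN2 opprK oppr0.
  by move=> /eqP x0; rewrite -vleN2 oppr0 -x0 vleUl.
apply: closed_comp; last exact: closed_le.
move=> x _; apply: cvg_norm; apply/cvgrPdist_le => /= eps eps0; near=> y.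
apply: le_trans (norm_vjoinB _ _ _ _) _; rewrite subrr normr0 addr0.
rewrite -opprD normrN; near: y; exact: cvgr_dist_le.
Unshelve. all: by end_near. Qed.

(** The contraction principle in the positive part of a ball: it yields positive
    solutions of equations, without summing any series. *)
Lemma positive_fixpoint (f : A -> A) (r q : R) : 0 <= r -> q < 1 ->
  (forall x, vle 0 x -> `|x| <= r -> vle 0 (f x) /\ `|f x| <= r) ->
  (forall x y, `|x| <= r -> `|y| <= r -> `|f x - f y| <= q * `|x - y|) ->
  exists2 x, vle 0 x & x = f x.
Proof.
move=> r0 q1 fU fq; pose U : set A := [set x | vle 0 x] `&` [set x | `|x| <= r].
have funU : {homo f : x / U x >-> U x} by move=> x [x0 xr]; exact: fU.
pose g := mkfun funU.
have [|||x [x0 _] xE] := @banach_fixed_point R A U g.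
- have q0 : 0 <= Num.max q 0 by rewrite le_max lexx orbT.
  exists (NngNum q0); split=> /=; first by rewrite gt_max q1 ltr01.
  move=> [x y] /= [[_ xr] [_ yr]]; apply: le_trans (fq _ _ xr yr) _.
  by rewrite ler_wpM2r// le_max lexx.
- apply: closedI; first exact: closed_nonneg.
  have -> : [set x : A | `|x| <= r] = (@Num.norm R A) @^-1` [set s | s <= r] by [].
  by apply: closed_comp; [move=> x _; exact: norm_continuous|exact: closed_le].
- by exists 0; split => /=; rewrite ?vlexx// normr0.
by exists x.
Qed.

(** Addition, joins and scaling are Lipschitz, and the product is Lipschitz on
    bounded sets. Only the variables that occur in p have to be controlled,
    which are finitely many even if X is a whole Banach space. *)
Lemma eval_close (X : eqType) (p : term R X) (b : X -> A) (eps : R) : 0 < eps ->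
  exists2 delta : R, 0 < delta & forall c : X -> A,
    (forall i, i \in vars p -> `|b i - c i| <= delta) ->
    `|eval b p - eval c p| <= eps.
Proof.
elim: p eps => [i||p IHp q IHq|a p IHp|p IHp q IHq|p IHp q IHq] eps eps0 /=.
- by exists eps => // c; apply; rewrite mem_seq1.
- by exists 1 => // c _; rewrite subrr normr0 ltW.
- have [d d0 hp] := IHp _ (divr_gt0 eps0 (ltr0n _ 2)).
  have [d' d'0 hq] := IHq _ (divr_gt0 eps0 (ltr0n _ 2)).
  exists (Num.min d d'); rewrite ?lt_min ?d0// => c hc.
  rewrite opprD addrACA; apply: le_trans (ler_normD _ _) _.
  have cp : `|eval b p - eval c p| <= eps / 2.
    by apply: hp => i xp; apply: le_trans (hc i _) _;
      rewrite ?ge_min ?lexx// mem_cat xp.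
  have cq : `|eval b q - eval c q| <= eps / 2.
    by apply: hq => i xp; apply: le_trans (hc i _) _;
      rewrite ?ge_min ?lexx ?orbT// mem_cat xp orbT.
  lra.
- have a0 : 0 < `|a| + 1 by rewrite ltr_wpDl.
  have [d d0 hp] := IHp _ (divr_gt0 eps0 a0).
  exists d => // c /hp; rewrite -scalerBr normrZ ler_pdivlMr//.
  apply: le_trans; rewrite mulrDr mulr1 mulrC lerDl; exact: normr_ge0.
- pose M := `|eval b p| + `|eval b q| + 1.
  have M0 : 0 < M by rewrite ltr_wpDl// addr_ge0.
  have e0 : 0 < Num.min 1 (eps / (2 * M)).
    by rewrite lt_min ltr01 divr_gt0// mulr_gt0.
  have [d d0 hp] := IHp _ e0; have [d' d'0 hq] := IHq _ e0.
  exists (Num.min d d'); rewrite ?lt_min ?d0// => c hc.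
  have := hp c; have := hq c.
  have hd i : i \in vars p -> `|b i - c i| <= d.
    by move=> xp; apply: le_trans (hc i _) _; rewrite ?ge_min ?lexx// mem_cat xp.
  have hd' i : i \in vars q -> `|b i - c i| <= d'.
    by move=> xp; apply: le_trans (hc i _) _;
      rewrite ?ge_min ?lexx ?orbT// mem_cat xp orbT.
  move=> /(_ hd') + /(_ hd); rewrite !le_min => /andP[_ cq] /andP[cp1 cp].
  apply: le_trans (norm_vmulB _ _ _ _) _.
  have cM : `|eval c p| <= M.
    have := ler_normB (eval b p) (eval b p - eval c p); rewrite subKr => h.
    by apply: le_trans h _; rewrite /M -addrA lerD2l ler_wpDl.
  have bM : `|eval b q| <= M by rewrite /M -addrA addrCA lerDl addr_ge0.
  apply: (@le_trans _ _ (eps / (2 * M) * M + M * (eps / (2 * M)))).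
    by rewrite lerD// ler_pM.
  rewrite le_eqVlt; apply/orP; left; apply/eqP; field.
  by rewrite gt_eqF.
- have [d d0 hp] := IHp _ (divr_gt0 eps0 (ltr0n _ 2)).
  have [d' d'0 hq] := IHq _ (divr_gt0 eps0 (ltr0n _ 2)).
  exists (Num.min d d'); rewrite ?lt_min ?d0// => c hc.
  apply: le_trans (norm_vjoinB _ _ _ _) _.
  have cp : `|eval b p - eval c p| <= eps / 2.
    by apply: hp => i xp; apply: le_trans (hc i _) _;
      rewrite ?ge_min ?lexx// mem_cat xp.
  have cq : `|eval b q - eval c q| <= eps / 2.
    by apply: hq => i xp; apply: le_trans (hc i _) _;
      rewrite ?ge_min ?lexx ?orbT// mem_cat xp orbT.
  lra.
Qed.

End BanachFAlgebra.

(** * Transfer of real inequalities to Banach f-algebras *)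

Section Transfer.
Context {R : realType} {A : banachFAlgType R}.

(** The solution is the geometric series x + x^2 + x^3 + ... *)
Lemma exists_geometric (x : A) : vle 0 x -> `|x| < 1 ->
  exists2 y, vle 0 y & y = x + vmul x y.
Proof.
move=> x0 x1.
apply: (@positive_fixpoint _ _ (fun y => x + vmul x y) (`|x| / (1 - `|x|)) `|x|).
- by rewrite divr_ge0// subr_ge0 ltW.
- by [].
- move=> y y0 yr; split; first by rewrite vaddr_ge0// vmul_ge0.
  apply: le_trans (ler_normD _ _) _.
  apply: (@le_trans _ _ (`|x| + `|x| * (`|x| / (1 - `|x|)))).
    by rewrite lerD2l (le_trans (ler_norm_vmul _ _))// ler_wpM2l.
  rewrite le_eqVlt; apply/orP; left; apply/eqP; field.
  by rewrite subr_eq0 gt_eqF.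
- by move=> y z _ _; rewrite opprD addrACA subrr add0r -vmulBr ler_norm_vmul.
Qed.

(** The equation makes e >= u and e^2 <= e hold at once. The bound 3/16 lets the
    ball of radius 1/4 be mapped into itself, since 3/16 + (1/4)^2 = 1/4. *)
Lemma exists_quadratic (u : A) : vle 0 u -> `|u| <= 3 / 16 ->
  exists2 e, vle 0 e & e = u + vmul e e.
Proof.
move=> u0 u1.
apply: (@positive_fixpoint _ _ (fun e => u + vmul e e) (4^-1) (2^-1)).
- by rewrite invr_ge0.
- by rewrite invf_lt1// ltr1n.
- move=> y y0 yr; split; first by rewrite vaddr_ge0// vmul_ge0.
  apply: le_trans (ler_normD _ _) _.
  have : `|vmul y y| <= 4^-1 * 4^-1.
    by apply: le_trans (ler_norm_vmul _ _) _; rewrite ler_pM.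
  lra.
- move=> y z yr zr; rewrite opprD addrACA subrr add0r.
  apply: le_trans (norm_vmulB _ _ _ _) _; rewrite [_ * `|y|]mulrC -mulrDl.
  by rewrite ler_wpM2r//; lra.
Qed.

(** The ideal generated by e has e as a strong unit, and it is a subalgebra
    because (r e) (s e) = r s e^2 <= r s e. *)
Lemma ideal_subfalg (e : A) : vle 0 e -> vle (vmul e e) e ->
  subfalg_closed [set x : A | exists2 r : R, 0 <= r & vle (modulus x) (r *: e)].
Proof.
move=> e0 ee; split => /=.
- by exists 0; rewrite // scale0r ge0_modulus vlexx.
- move=> x y [r r0 xr] [s s0 ys]; exists (r + s); first exact: addr_ge0.
  by apply: vle_trans (modulusD _ _) _; rewrite scalerDl vleD.
- move=> a x [r r0 xr]; exists (`|a| * r); first exact: mulr_ge0.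
  by rewrite modulusZ -scalerA vscaler_le.
- move=> x y [r r0 xr] [s s0 ys]; exists (r + s); first exact: addr_ge0.
  have := vjoin_close x y 0 0; rewrite (vjoin_eqr (vlexx 0)) !subr0.
  by move=> h; apply: vle_trans h _; rewrite scalerDl vleD.
- move=> x y [r r0 xr] [s s0 ys]; exists (r * s); first exact: mulr_ge0.
  apply: vle_trans (modulus_vmul x y) _.
  apply: vle_trans (vmul_le (modulus_ge0 _) (modulus_ge0 _) xr ys) _.
  by rewrite vmulZl vmulZr scalerA; apply: vscaler_le => //; exact: mulr_ge0.
Qed.

Context {I : finType}.

(** Let e generate an ideal that contains the sums y_i of the geometric series of
    x_i = |s_i| / rho, with e^2 <= e. If the inequality failed in A, some lattice
    homomorphism phi from this ideal to the reals would detect it, and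
    phi (xy) = w phi (x) phi (y) for some w >= 0. Applying phi to
    y_i = x_i + x_i y_i forces w phi (x_i) <= 1, so that the point
    (w phi (s_i))_i lies in the cube where the inequality is known. After
    division by w this contradicts the choice of phi. *)
Lemma eval_le (p q : term R I) (rho : R) (s : I -> A) : 0 < rho ->
  (forall t : I -> R, (forall i, `|t i| <= rho) -> reval 1 t p <= reval 1 t q) ->
  (forall i, `|s i| < rho) ->
  vle (eval s p) (eval s q).
Proof.
move=> rho0 real_le s_lt.
pose x i := rho^-1 *: modulus (s i).
have x0 i : vle 0 (x i) by rewrite vscaler_ge0 ?modulus_ge0// invr_ge0 ltW.
have x1 i : `|x i| < 1.
  rewrite normrZ norm_modulus gtr0_norm ?invr_gt0//.
  by rewrite ltr_pdivrMl// mulr1.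
have /choice[y yP] i : exists y, vle 0 y /\ y = x i + vmul (x i) y.
  by have [y] := exists_geometric (x0 i) (x1 i); exists y.
(* Scaling the sum of the y_i down makes the quadratic equation for e solvable
   without changing the ideal. *)
pose Y := \sum_i y i; pose lam : R := 3 / 16 / (`|Y| + 1).
have lam0 : 0 < lam by rewrite !divr_gt0// ltr_wpDl.
have Y0 : vle 0 Y by apply: vsumr_ge0 => i _; have [] := yP i.
have [||e e0 eE] := @exists_quadratic (lam *: Y).
- by rewrite vscaler_ge0// ltW.
- rewrite normrZ gtr0_norm// /lam mulrAC ler_pdivrMr ?ltr_wpDl//.
  by rewrite ler_pM2l ?divr_gt0// lerDl.
have ee : vle (vmul e e) e.
  by rewrite {3}eE -[X in vle X _]add0r vleD ?vlexx// vscaler_ge0// ltW.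
have ye i : vle (y i) (lam^-1 *: e).
  have h : vle (lam *: y i) e.
    rewrite eE -[X in vle X _]addr0 vleD ?vmul_ge0//.
    by apply: vscaler_le (ltW lam0) _; apply: vler_sum1 => j; have [] := yP j.
  have := vscaler_le (_ : 0 <= lam^-1) h.
  by rewrite scalerA mulVf ?gt_eqF// scale1r invr_ge0 (ltW lam0); apply.
have xy i : vle (x i) (y i).
  have [yi0 yE] := yP i; rewrite [X in vle _ X]yE.
  by rewrite -[X in vle X _]addr0 vleD ?vlexx ?vmul_ge0.
have HS := ideal_subfalg e0 ee.
set S := [set x : A | _] in HS; pose U := subfalg HS.
have Se : S e by exists 1; rewrite ?ler01// scale1r ge0_modulus ?vlexx.
have Sy i : S (y i).
  by exists lam^-1; [rewrite invr_ge0 ltW|rewrite ge0_modulus ?(yP i).1].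
have Ss i : S (s i).
  exists (rho * lam^-1); first by rewrite mulr_ge0 ?invr_ge0 ?ltW.
  have -> : modulus (s i) = rho *: x i by rewrite scalerA mulfV ?scale1r// gt_eqF.
  rewrite -scalerA; apply: vscaler_le (ltW rho0) _.
  exact: vle_trans (xy i) (ye i).
pose eU : U := subfalg_mk HS Se; pose sU i : U := subfalg_mk HS (Ss i).
pose yU i : U := subfalg_mk HS (Sy i); pose xU i : U := rho^-1 *: modulus (sU i).
have val_hom : lattice_algebra_hom (val : U -> A) by split.
have valE r : val (eval sU r) = eval s r by rewrite (hom_eval _ _ val_hom).
rewrite -!valE -[vle _ _]/(vle (eval sU p) (eval sU q)) -subv_le0.
apply/negPn/negP => pq.
have eU0 : vle 0 eU by exact: e0.
have U_arch (v z : U) : (forall eps : R, 0 < eps -> vle v (eps *: z)) -> vle v 0.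
  exact: (@banach_archimedean _ _ (val v) (val z)).
have U_unit (v : U) : exists r, vle v (r *: eU).
  have [r _ vr] := subfalgP v; exists r.
  exact: (vle_trans _ _ _ (vle_modulus (val v)) vr).
have [phi hphi phi_pq] :=
  lattice_functional_separates eU0 U_unit U_arch pq.
have phi_e : 0 < phi eU.
  rewrite lt_neqAle (lfun_ge0 hphi eU0) andbT; apply/eqP => phi_e.
  have [r /(lfun_le hphi)] := U_unit (eval sU p - eval sU q).
  by rewrite (lfunZ hphi) -phi_e mulr0 leNgt phi_pq.
have phiM := lfun_mul hphi _ _ phi_e.
set w := phi (vmul eU eU) / phi eU ^+ 2 in phiM.
have w0 : 0 <= w by rewrite divr_ge0 ?sqr_ge0// (lfun_ge0 hphi)// vmul_ge0.
pose t := phi \o sU.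
have t_bound i : w * `|t i| <= rho.
  have xE : phi (xU i) = rho^-1 * `|t i| by rewrite (lfunZ hphi) (lfun_modulus hphi).
  have phix : 0 <= phi (xU i) by rewrite xE mulr_ge0// invr_ge0 ltW.
  have phiy : 0 <= phi (yU i) by apply: (lfun_ge0 hphi); have [] := yP i.
  have yUE : yU i = xU i + vmul (xU i) (yU i).
    by apply: val_inj; have [_] := yP i.
  have := congr1 phi yUE; rewrite (lfunD hphi) phiM => phiyE.
  have : w * phi (xU i) <= 1.
    rewrite leNgt; apply/negP => h.
    have phix_gt0 : 0 < phi (xU i).
      by rewrite lt_neqAle phix andbT; apply: contraTneq h => <-; rewrite mulr0 ltr10.
    have : phi (yU i) <= w * phi (xU i) * phi (yU i) by rewrite ler_peMl// ltW.
    by rewrite {1}phiyE; lra.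
  by rewrite xE mulrCA ler_pdivrMl// mulr1.
have le_pos v : 0 < v -> (forall i, v * `|t i| <= rho) -> reval v t p <= reval v t q.
  move=> v0 vt; rewrite -(ler_pM2l v0) !reval_rescale ?(ltW v0)//.
  by apply: real_le => i; rewrite normrM gtr0_norm.
suff : reval w t p <= reval w t q.
  rewrite -!(lfun_eval _ _ hphi phiM) leNgt => /negP; apply.
  by move: phi_pq; rewrite (lfunD hphi) (lfunN hphi) subr_gt0.
move: w0; rewrite le_eqVlt => /predU1P[<-|w0]; last exact: le_pos.
(* The real line with zero product is not isomorphic to the usual one, but it is
   a limit of the isomorphic copies of product v x y as v > 0 tends to 0. *)
pose M : R := \sum_i `|t i| + 1.
have M0 : 0 < M by rewrite ltr_wpDl// sumr_ge0.
apply: (@ler_cvg_to _ (0^'+) _ _ (fun v => reval v t p) (fun v => reval v t q)).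
- exact/cvg_at_right_filter/reval_continuous.
- exact/cvg_at_right_filter/reval_continuous.
- near=> v; have v0 : 0 < v by near: v; exact: nbhs_right_gt.
  apply: (le_pos) => // i; apply: (@le_trans _ _ (v * M)).
    by rewrite ler_pM2l// /M (bigD1 i)//= -addrA lerDl addr_ge0// sumr_ge0.
  rewrite -ler_pdivlMr//; near: v; apply: nbhs_right_ltW.
  exact: divr_gt0.
Unshelve. all: by end_near. Qed.

End Transfer.

(** * The largest norm on a finite set of points *)

(** Completeness passes to a space that embeds, up to equivalence of norms,
    onto a closed subset of a complete space. *)
Lemma complete_embedding (R : realType) (V : normedModType R)
    (W : normedModType R) (j : V -> W) (M : R) : 0 < M ->
  (forall F : set_system W, ProperFilter F -> cauchy F -> cvg F) ->
  (forall x y, `|j x - j y| <= `|x - y|) ->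
  (forall x y, `|x - y| <= M * `|j x - j y|) ->
  (forall w, closure (range j) w -> range j w) ->
  forall F : set_system V, ProperFilter F -> cauchy F -> cvg F.
Proof.
move=> M0 W_complete j1 jM jcl F FF /cauchyP Fc.
have Gc : cauchy (j @ F).
  apply/cauchyP => eps /Fc[x Fx]; exists (j x).
  suff : F (j @^-1` ball (j x) eps) by [].
  by apply: filterS Fx => y; rewrite /= -!ball_normE/=; apply: le_lt_trans.
have jw : j @ F --> lim (j @ F) by exact: W_complete.
set w := lim _ in jw.
have [|v _ vw] := jcl w.
  move=> B /jw FB; have /filter_ex[y By] : F (j @^-1` B) by [].
  by exists (j y); split => //; exists y.
apply: (cvgP v); apply/cvgrPdist_le => eps eps0.
move: jw; rewrite -vw => /cvgrPdist_le/(_ _ (divr_gt0 eps0 M0)); apply: filterS.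
by move=> y; rewrite ler_pdivlMr// mulrC; apply: le_trans (jM _ _).
Qed.

Lemma coord_le_norm (R : realType) m (g : 'rV[R]_m) k : `|g 0 k| <= `|g|.
Proof.
rewrite [leRHS](mx_normrE g).
exact: (@le_bigmax _ _ _ 0 (fun ij => `|g ij.1 ij.2|) (0, k)).
Qed.

Section WordCombinations.
Context {R : realType} {I : finType}.
Implicit Types (t : I -> R) (u : I * seq I) (c : seq (R * (I * seq I))).

(** A word is a first letter together with a list of letters: the empty word
    would be a unit, which the algebras at hand do not have. A list of pairs of a
    coefficient and a word is an element of the semigroup algebra; its cost is
    the l_1-norm, which is why cost and value are multiplicative. *)
Definition word_val t u : R := `|t u.1| * \prod_(i <- u.2) `|t i|.

Definition comb_cost c : R := \sum_(x <- c) x.1.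
Definition comb_val t c : R := \sum_(x <- c) x.1 * word_val t x.2.
Definition comb_ge0 c := all (fun x => 0 <= x.1) c.

Definition comb_scale (a : R) c := [seq (a * x.1, x.2) | x <- c].
Definition comb_mul c c' :=
  [seq (x.1 * y.1, (x.2.1, x.2.2 ++ y.2.1 :: y.2.2)) | x <- c, y <- c'].

Lemma word_val_ge0 t u : 0 <= word_val t u.
Proof. by rewrite mulr_ge0// prodr_ge0. Qed.

Lemma word_val_le t u (rho : R) : rho <= 1 -> (forall i, `|t i| <= rho) ->
  word_val t u <= `|t u.1| * rho ^+ size u.2.
Proof.
move=> rho1 t_le; rewrite ler_wpM2l//; elim: u.2 => [|i s IHs].
  by rewrite big_nil.
by rewrite big_cons exprS ler_pM// prodr_ge0.
Qed.

Lemma word_val_le1 t u : (forall i, `|t i| <= 1) -> word_val t u <= 1.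
Proof.
move=> t1; apply: le_trans (word_val_le _ (lexx _) t1) _.
by rewrite expr1n mulr1.
Qed.

Lemma comb_cost_ge0 c : comb_ge0 c -> 0 <= comb_cost c.
Proof. by move=> /allP h; rewrite /comb_cost big_seq sumr_ge0. Qed.

Lemma comb_val_le t c : (forall i, `|t i| <= 1) -> comb_ge0 c ->
  comb_val t c <= comb_cost c.
Proof.
move=> t1 /allP h; rewrite /comb_val /comb_cost big_seq [leRHS]big_seq.
by apply: ler_sum => x /h/= x0; rewrite ler_piMr// word_val_le1.
Qed.

Lemma comb_cost_cat c c' : comb_cost (c ++ c') = comb_cost c + comb_cost c'.
Proof. by rewrite /comb_cost big_cat. Qed.

Lemma comb_val_cat t c c' : comb_val t (c ++ c') = comb_val t c + comb_val t c'.
Proof. by rewrite /comb_val big_cat. Qed.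

Lemma comb_cost_scale a c : comb_cost (comb_scale a c) = a * comb_cost c.
Proof. by rewrite /comb_cost big_map mulr_sumr. Qed.

Lemma comb_val_scale t a c : comb_val t (comb_scale a c) = a * comb_val t c.
Proof.
by rewrite /comb_val big_map mulr_sumr; apply: eq_bigr => x _; rewrite mulrA.
Qed.

Lemma comb_ge0_scale a c : 0 <= a -> comb_ge0 c -> comb_ge0 (comb_scale a c).
Proof.
by move=> a0 /allP h; rewrite /comb_ge0 all_map; apply/allP => x /h; exact: mulr_ge0.
Qed.

Lemma comb_cost_mul c c' : comb_cost (comb_mul c c') = comb_cost c * comb_cost c'.
Proof.
rewrite /comb_cost big_allpairs_dep/= mulr_suml; apply: eq_bigr => x _.
by rewrite mulr_sumr.
Qed.

Lemma comb_val_mul t c c' :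
  comb_val t (comb_mul c c') = comb_val t c * comb_val t c'.
Proof.
rewrite /comb_val big_allpairs_dep/= mulr_suml; apply: eq_bigr => x _.
rewrite mulr_sumr; apply: eq_bigr => y _.
by rewrite /word_val/= big_cat big_cons/=; ring.
Qed.

Lemma comb_ge0_mul c c' : comb_ge0 c -> comb_ge0 c' -> comb_ge0 (comb_mul c c').
Proof.
move=> /allP h /allP h'; apply/allP => z /allpairsP[[x y] /= [/h x0 /h' y0 ->]] /=.
exact: mulr_ge0.
Qed.

End WordCombinations.

Section PointAlgebra.
Context {R : realType} {I : finType} {m : nat}.

(** The points have to be nonzero for the norm below to be finite, and in the
    unit cube for it to vanish only at 0. *)
Record points := Points {
  point :> 'I_m -> I -> R;
  point_le1 : forall k i, `|point k i| <= 1;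
  point_neq0 : forall k, exists i, point k i != 0 }.

Variable t : points.

(** An alias of the space of functions on the points, which keeps the norm below
    apart from the supremum norm. *)
Definition point_alg of points := 'rV[R]_m.
Local Notation B := (point_alg t).

HB.instance Definition _ := GRing.Lmodule.on B.

Implicit Types (g h : 'rV[R]_m).

Definition dominated g (r : R) := exists c, [/\ comb_ge0 c, comb_cost c <= r &
  forall k, `|g 0 k| <= comb_val (t k) c].

(** The largest submultiplicative lattice norm for which all coordinate
    functions have norm at most one. *)
Definition point_norm (g : B) : R := inf [set r | dominated g r].

Lemma dominated_ge g r k : dominated g r -> `|g 0 k| <= r.
Proof.
move=> [c [c0 cr /(_ k) gc]]; apply: le_trans gc _; apply: le_trans cr.
by apply: comb_val_le => //; exact: point_le1.
Qed.

Lemma dominated_ge0 g r : dominated g r -> 0 <= r.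
Proof. by move=> [c [/comb_cost_ge0 c0 cr _]]; exact: le_trans c0 cr. Qed.

Lemma dominatedD g h r s : dominated g r -> dominated h s -> dominated (g + h) (r + s).
Proof.
move=> [c [c0 cr gc]] [c' [c'0 cs hc]]; exists (c ++ c'); split.
- by rewrite /comb_ge0 all_cat; apply/andP.
- by rewrite comb_cost_cat lerD.
- by move=> k; rewrite mxE comb_val_cat (le_trans (ler_normD _ _))// lerD.
Qed.

Lemma dominatedZ g r (a : R) : dominated g r -> dominated (a *: g) (`|a| * r).
Proof.
move=> [c [c0 cr gc]]; exists (comb_scale `|a| c); split.
- exact: comb_ge0_scale.
- by rewrite comb_cost_scale ler_wpM2l.
- by move=> k; rewrite mxE comb_val_scale normrM ler_wpM2l.
Qed.

Lemma dominatedM g h r s : dominated g r -> dominated h s ->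
  dominated (\row_k (g 0 k * h 0 k)) (r * s).
Proof.
move=> [c [c0 cr gc]] [c' [c'0 cs hc]]; exists (comb_mul c c'); split.
- exact: comb_ge0_mul.
- by rewrite comb_cost_mul ler_pM// comb_cost_ge0.
- by move=> k; rewrite mxE comb_val_mul normrM ler_pM.
Qed.

Lemma dominated_le g h r : (forall k, `|g 0 k| <= `|h 0 k|) ->
  dominated h r -> dominated g r.
Proof.
by move=> gh [c [c0 cr hc]]; exists c; split=> // k; exact: le_trans (gh k) (hc k).
Qed.

(** The k-th point has a nonzero coordinate, so a multiple of one letter is at
    least 1 there. The constant M is uniform, which makes the norm equivalent to
    the supremum norm, hence complete. *)
Lemma dominated_ex : exists2 M : R, 0 < M &
  forall g s, 0 <= s -> (forall k, `|g 0 k| <= s) -> dominated g (M * s).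
Proof.
have /choice[i ti] := point_neq0 t.
pose c : seq (R * (I * seq I)) := [seq (`|t k (i k)|^-1, (i k, [::])) | k <- enum 'I_m].
have c0 : comb_ge0 c by apply/allP => _ /mapP[k _ ->] /=; rewrite invr_ge0.
exists (comb_cost c + 1); first by rewrite ltr_wpDl// comb_cost_ge0.
move=> g s s0 gs; exists (comb_scale s c); split.
- exact: comb_ge0_scale.
- by rewrite comb_cost_scale mulrC ler_wpM2r// lerDl.
- move=> k; apply: le_trans (gs k) _; rewrite comb_val_scale ler_peMr//.
  rewrite /comb_val big_map big_enum/= (bigD1 k)//=.
  rewrite {1}/word_val/= big_nil mulr1 mulVf ?normr_eq0// lerDl sumr_ge0// => l _.
  by rewrite mulr_ge0 ?invr_ge0 ?word_val_ge0.
Qed.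

Lemma point_norm_le g r : dominated g r -> point_norm g <= r.
Proof.
move=> gr; apply: ge_inf => //; exists 0 => s /=; exact: dominated_ge0.
Qed.

Lemma dominated_nonempty g : [set r | dominated g r] !=set0.
Proof.
have [M M0 h] := dominated_ex; exists (M * `|g|); apply: h => // k.
exact: coord_le_norm.
Qed.

Lemma point_norm_lt g r : point_norm g < r -> dominated g r.
Proof.
move=> /(inf_lt (dominated_nonempty g))[s [c [c0 cs gc]] sr].
by exists c; split=> //; exact: le_trans cs (ltW sr).
Qed.

Lemma le_point_norm g r : (forall s, dominated g s -> r <= s) -> r <= point_norm g.
Proof.
by move=> h; apply: lb_le_inf; [exact: dominated_nonempty|move=> s /h].
Qed.

Fact point_norm_ge0 g : 0 <= point_norm g.
Proof. by apply: le_point_norm => s /dominated_ge0. Qed.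

Fact point_normD (g h : B) : point_norm (g + h) <= point_norm g + point_norm h.
Proof.
rewrite -lerBlDr; apply: le_point_norm => r gr.
rewrite lerBlDr -lerBlDl; apply: le_point_norm => s hs; rewrite lerBlDl.
exact/point_norm_le/dominatedD.
Qed.

Fact point_normZ (a : R) (g : B) : point_norm (a *: g) = `|a| * point_norm g.
Proof.
have le (b : R) h : point_norm (b *: h) <= `|b| * point_norm h.
  have [->|b0] := eqVneq b 0.
    rewrite normr0 mul0r; apply: point_norm_le.
    rewrite scale0r; exists [::]; split=> // [|k];
      by rewrite ?mxE ?normr0 ?/comb_val ?/comb_cost big_nil.
  rewrite -ler_pdivrMl ?normr_gt0//; apply: le_point_norm => r /(@dominatedZ _ _ b).
  by move/point_norm_le; rewrite ler_pdivrMl ?normr_gt0.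
apply/eqP; rewrite eq_le le/=; have [->|a0] := eqVneq a 0.
  by rewrite normr0 mul0r point_norm_ge0.
rewrite -ler_pdivlMl ?normr_gt0// -normfV.
by have := le a^-1 (a *: g); rewrite scalerA mulVf// scale1r.
Qed.

Lemma coord_le_point_norm (g : B) k : `|g 0 k| <= point_norm g.
Proof. by apply: le_point_norm => r; exact: dominated_ge. Qed.

Fact point_norm_eq0 (g : B) : point_norm g = 0 -> g = 0.
Proof.
move=> g0; apply/rowP => k; rewrite mxE; apply/eqP.
by rewrite -normr_le0 -g0 coord_le_point_norm.
Qed.

HB.instance Definition _ := Lmodule_isNormed.Build R B
  point_normD point_normZ point_norm_eq0.

Fact point_complete (F : set_system B) : ProperFilter F -> cauchy F -> cvg F.
Proof.
have [M M0 h] := dominated_ex.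
apply: (@complete_embedding R B 'rV[R]_m (fun g => g) M M0).
- exact: cauchy_cvg.
- move=> g g'; rewrite [leLHS](mx_normrE (g - g')); apply/bigmax_leP.
  split=> [|[i k] _ /=]; first exact: normr_ge0.
  by rewrite ord1; exact: (coord_le_point_norm (g - g')).
- by move=> g g'; apply/point_norm_le/h => // k; exact: coord_le_norm.
- by move=> g _; exists g.
Qed.

HB.instance Definition _ := Uniform_isComplete.Build B point_complete.

Let le : rel B := fun g h => [forall k, g 0 k <= h 0 k].
Let meet (g h : B) : B := \row_k Num.min (g 0 k) (h 0 k).
Let join (g h : B) : B := \row_k Num.max (g 0 k) (h 0 k).
Let mul (g h : B) : B := \row_k (g 0 k * h 0 k).

Fact point_le_refl : reflexive le. Proof. by move=> g; apply/forallP => k. Qed.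
Fact point_le_anti : antisymmetric le.
Proof.
move=> g h /andP[/forallP gh /forallP hg]; apply/rowP => k.
by apply/eqP; rewrite eq_le gh hg.
Qed.
Fact point_le_trans : transitive le.
Proof.
by move=> h g f /forallP gh /forallP hf; apply/forallP => k; exact: le_trans (hf k).
Qed.
Fact point_lexI f g h : le f (meet g h) = le f g && le f h.
Proof.
apply/forallP/andP => [fgh|[/forallP fg /forallP fh] k]; last first.
  by rewrite mxE le_min fg fh.
by split; apply/forallP => k; have := fgh k; rewrite mxE le_min => /andP[].
Qed.
Fact point_leUx f g h : le (join g h) f = le g f && le h f.
Proof.
apply/forallP/andP => [ghf|[/forallP gf /forallP hf] k]; last first.
  by rewrite mxE ge_max gf hf.
by split; apply/forallP => k; have := ghf k; rewrite mxE ge_max => /andP[].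
Qed.
Fact point_leD2r f g h : le g h -> le (g + f) (h + f).
Proof. by move=> /forallP gh; apply/forallP => k; rewrite !mxE lerD2r. Qed.
Fact point_scaler_ge0 (a : R) g : 0 <= a -> le 0 g -> le 0 (a *: g).
Proof.
move=> a0 /forallP g0; apply/forallP => k.
by have := g0 k; rewrite !mxE => gk; exact: mulr_ge0.
Qed.

HB.instance Definition _ := isVectorLattice.Build R B point_le_refl
  point_le_anti point_le_trans point_lexI point_leUx point_leD2r
  point_scaler_ge0.

Fact point_mulA : associative mul.
Proof. by move=> f g h; apply/rowP => k; rewrite !mxE mulrA. Qed.
Fact point_mulDl : left_distributive mul +%R.
Proof. by move=> f g h; apply/rowP => k; rewrite !mxE mulrDl. Qed.
Fact point_mulDr : right_distributive mul +%R.
Proof. by move=> f g h; apply/rowP => k; rewrite !mxE mulrDr. Qed.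
Fact point_mulZl (a : R) f g : mul (a *: f) g = a *: mul f g.
Proof. by apply/rowP => k; rewrite !mxE mulrA. Qed.
Fact point_mulZr (a : R) f g : mul f (a *: g) = a *: mul f g.
Proof. by apply/rowP => k; rewrite !mxE mulrCA. Qed.
Fact point_mul_ge0 (f g : B) : vle 0 f -> vle 0 g -> vle 0 (mul f g).
Proof.
move=> /forallP f0 /forallP g0; apply/forallP => k.
by have := f0 k; have := g0 k; rewrite !mxE => gk fk; exact: mulr_ge0.
Qed.

HB.instance Definition _ := isVectorLatticeAlgebra.Build R B point_mulA
  point_mulDl point_mulDr point_mulZl point_mulZr point_mul_ge0.

Fact point_mul_disjoint (a b c : B) : vmeet a b = 0 -> vle 0 c ->
  vmeet (vmul a c) b = 0 /\ vmeet (vmul c a) b = 0.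
Proof.
have key (x y z : R) : Num.min x y = 0 -> 0 <= z -> Num.min (x * z) y = 0.
  move=> + z0; case: (leP x y) => [xy x0|yx y0].
    by rewrite x0 mul0r min_l// -x0.
  by rewrite y0 min_r// mulr_ge0// -y0 ltW.
move=> /rowP ab /forallP c0; split; apply/rowP => k; rewrite !mxE; last rewrite mulrC.
all: have := ab k; have := c0 k; rewrite !mxE => ck abk; exact: key.
Qed.

HB.instance Definition _ := isFAlgebra.Build R B point_mul_disjoint.

Lemma point_modulusE (g : B) k : modulus g 0 k = `|g 0 k|.
Proof.
rewrite mxE mxE; have [h|h] := leP 0 (g 0 k).
  by rewrite ger0_norm// max_l// (le_trans _ h)// oppr_le0.
by rewrite ltr0_norm// max_r// (le_trans (ltW h))// oppr_ge0 ltW.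
Qed.

Fact point_norm_modulus (g h : B) : vle (modulus g) (modulus h) -> `|g| <= `|h|.
Proof.
move=> /forallP gh; apply: le_point_norm => r hr; apply/point_norm_le.
by apply: dominated_le hr => k; rewrite -!point_modulusE; exact: gh.
Qed.

Fact point_norm_mul (g h : B) : `|vmul g h| <= `|g| * `|h|.
Proof.
set a := `|g|; set b := `|h|; rewrite leNgt; apply/negP => ab.
have a0 : 0 <= a by exact: normr_ge0.
have b0 : 0 <= b by exact: normr_ge0.
pose d := (`|vmul g h| - a * b) / (a + b + 2).
have ab2 : 0 < a + b + 2 by lra.
have d0 : 0 < d by rewrite divr_gt0// subr_gt0.
have dE : d * (a + b + 2) = `|vmul g h| - a * b by rewrite /d divfK// gt_eqF.
pose eps := Num.min 1 d.
have eps0 : 0 < eps by rewrite lt_min ltr01.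
have [eps1 epsd] : eps <= 1 /\ eps <= d by rewrite !ge_min !lexx orbT.
have gd : dominated g (a + eps) by apply: point_norm_lt; rewrite ltrDl.
have hd : dominated h (b + eps) by apply: point_norm_lt; rewrite ltrDl.
have : `|vmul g h| <= (a + eps) * (b + eps) := point_norm_le (dominatedM gd hd).
have : eps * (a + b + 2) <= d * (a + b + 2) by rewrite ler_pM2r.
have : eps * eps <= eps * 1 by rewrite ler_pM2l.
rewrite dE; nra.
Qed.

HB.instance Definition _ :=
  isBanachFAlgebra.Build R B point_norm_modulus point_norm_mul.

Lemma point_alg_semiprime : semiprime B.
Proof.
move=> g /rowP gg; apply/rowP => k; have := gg k; rewrite !mxE => /eqP.
by rewrite mulf_eq0 orbb => /eqP.
Qed.

Lemma point_alg_findim : finite_dimensional B.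
Proof.
have lin : linear (fun g : B => g : 'rV[R]_m) by [].
pose f : {linear B -> 'rV[R]_m} :=
  HB.pack (fun g : B => g : 'rV[R]_m) (GRing.isLinear.Build _ _ _ _ _ lin).
by exists m, f; exists (fun g => g).
Qed.

Definition point_coord (i : I) : B := \row_k t k i.

Lemma norm_point_coord i : `|point_coord i| <= 1.
Proof.
apply: point_norm_le; exists [:: (1, (i, [::]))]; split => //=.
- by rewrite /comb_ge0/= ler01.
- by rewrite /comb_cost big_seq1.
- by move=> k; rewrite mxE /comb_val big_seq1 mul1r /word_val/= big_nil mulr1.
Qed.

Lemma eval_point_coord (p : term R I) k :
  eval point_coord p 0 k = reval 1 (t k) p.
Proof.
elim: p => [i||p IHp q IHq|a p IHp|p IHp q IHq|p IHp q IHq] /=;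
  by rewrite !mxE ?IHp ?IHq ?mul1r.
Qed.

Lemma norm_point_alg_lt g r : `|g : B| < r -> dominated g r.
Proof. exact: point_norm_lt. Qed.

End PointAlgebra.

(** * Norms of terms with contractive variables *)

Section Truncation.
Context {R : realType} {I : finType}.
Implicit Types (t : I -> R) (c : seq (R * (I * seq I))).

Definition short_word (m : nat) : finType := (I * m.-bseq I)%type.

Definition long (m : nat) (w : short_word m) : I * seq I := (w.1, val w.2).

Lemma sum_short_word m (u : I * seq I) (x : R) :
  \sum_(w : short_word m | long w == u) x = if (size u.2 <= m)%N then x else 0.
Proof.
case: u => a l; case: ifPn => um.
  by rewrite (big_pred1 ((a, Bseq um) : short_word m)).
rewrite big1// => -[i v] /= /eqP[_ vl]; move: um => /=.
by rewrite -vl size_bseq.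
Qed.

(** The coefficients of the words of bounded length, collected by word: this
    replaces lists of arbitrary length by points of a finite-dimensional
    space. *)
Definition truncation m c (w : short_word m) : R :=
  \sum_(x <- c | long w == x.2) x.1.

Lemma truncation_ge0 m c w : comb_ge0 c -> 0 <= @truncation m c w.
Proof.
move=> /allP c0; rewrite /truncation big_seq_cond sumr_ge0// => x /andP[xc _].
exact: c0.
Qed.

Lemma truncation_cost m c : comb_ge0 c ->
  \sum_(w : short_word m) truncation c w <= comb_cost c.
Proof.
move=> /allP c0; rewrite /truncation /comb_cost.
rewrite (exchange_big_dep predT)//= big_seq [leRHS]big_seq.
apply: ler_sum => x xc; rewrite sum_short_word; case: ifP => // _; exact: c0.
Qed.

(** On the cube of side rho < 1 a word of length more than m is at most rho^m
    times the modulus of its first letter. *)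
Lemma truncation_val m c t (rho D delta : R) : comb_ge0 c ->
  0 <= rho -> rho <= 1 -> (forall i, `|t i| <= rho) ->
  comb_cost c <= D -> D * rho ^+ m <= delta ->
  comb_val t c <=
    \sum_(w : short_word m) truncation c w * word_val t (long w)
    + delta * \sum_i `|t i|.
Proof.
move=> c0' rho0 rho1 t_le cD Dm; have /allP c0 := c0'.
have -> : \sum_(w : short_word m) truncation c w * word_val t (long w) =
    \sum_(x <- c) if (size x.2.2 <= m)%N then x.1 * word_val t x.2 else 0.
  under eq_bigr do rewrite /truncation mulr_suml.
  rewrite (exchange_big_dep predT)//=; apply: eq_bigr => x _.
  rewrite -sum_short_word; apply: eq_bigr => w /eqP ->; by [].
have S0 : 0 <= \sum_i `|t i| by exact: sumr_ge0.
apply: (@le_trans _ _ (\sum_(x <- c) ((if (size x.2.2 <= m)%N then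
    x.1 * word_val t x.2 else 0) + x.1 * (rho ^+ m * \sum_i `|t i|)))).
  rewrite /comb_val big_seq [leRHS]big_seq; apply: ler_sum => x /c0/= x0.
  case: ifPn => [_|]; first by rewrite lerDl mulr_ge0// mulr_ge0// exprn_ge0.
  rewrite -ltnNge add0r => mx; rewrite ler_wpM2l//.
  apply: le_trans (word_val_le _ rho1 t_le) _; rewrite mulrC ler_pM ?exprn_ge0//.
    by rewrite ler_wiXn2l// ltnW.
  by rewrite (bigD1 x.2.1)//= lerDl sumr_ge0.
rewrite big_split/= lerD2l -mulr_suml mulrA ler_wpM2r//.
by apply: le_trans Dm; rewrite ler_wpM2r// exprn_ge0.
Qed.

End Truncation.

Lemma reval0 (R : realType) (X : Type) w (p : term R X) : reval w (fun=> 0) p = 0.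
Proof.
by elim: p => //= [p -> q ->|a p ->|p -> q ->|p -> q ->];
  rewrite ?addr0 ?mulr0 ?maxxx.
Qed.

Lemma rV_linear_continuous (R : realType) n (W : Type) (f : W -> 'I_n)
    (a : W -> R) (r : seq W) :
  continuous (fun c : 'rV[R]_n => \sum_(w <- r) c 0 (f w) * a w).
Proof.
elim: r => [|w r IHr].
  rewrite (_ : (fun c => _) = (fun=> 0)); first exact: cst_continuous.
  by apply/funext => c; rewrite big_nil.
rewrite (_ : (fun c => _) = (fun c : 'rV[R]_n =>
      c 0 (f w) * a w + \sum_(v <- r) c 0 (f v) * a v)).
  move=> c.
  apply: (@continuousD _ _ _ (fun c : 'rV[R]_n => c 0 (f w) * a w)); last exact: IHr.
  apply: (@continuousM _ _ (fun c : 'rV[R]_n => c 0 (f w)) (fun=> a w)).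
    exact: coord_continuous.
  exact: cst_continuous.
by apply/funext => c; rewrite big_cons.
Qed.

Section MajorantExists.
Context {R : realType} {I : finType}.
Variables (p : term R I) (C : R).
Hypothesis C_bound : forall (B : banachFAlgType R) (b : I -> B),
  semiprime B -> finite_dimensional B -> (forall i, `|b i| <= 1) ->
  `|eval b p| <= C.

Let C_ge0 : 0 <= C.
Proof.
have nz (k : 'I_0) : exists i, (fun (_ : 'I_0) (_ : I) => 0 : R) k i != 0 by case: k.
have le1 (k : 'I_0) i : `|(fun (_ : 'I_0) (_ : I) => 0 : R) k i| <= 1 by case: k.
pose B := point_alg (Points le1 nz).
apply: le_trans (C_bound (b := fun=> 0 : B) _ _ _); first exact: normr_ge0.
- exact: point_alg_semiprime.
- exact: point_alg_findim.
- by move=> i; rewrite normr0.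
Qed.

(** The norm of p in the algebra of functions on finitely many points is at most
    C, and by definition it is the infimum of the costs of the majorants of p on
    these points. *)
Lemma finite_majorant m (t : 'I_m -> I -> R) (D : R) : C < D ->
  (forall k i, `|t k i| <= 1) -> (forall k, exists i, t k i != 0) ->
  exists c, [/\ comb_ge0 c, comb_cost c <= D &
    forall k, `|reval 1 (t k) p| <= comb_val (t k) c].
Proof.
move=> CD t1 t0; pose P := Points t1 t0.
have := C_bound (@point_alg_semiprime _ _ _ P) (@point_alg_findim _ _ _ P)
  (@norm_point_coord _ _ _ P).
move=> /le_lt_trans/(_ CD)/norm_point_alg_lt[c [c0 cD cP]]; exists c; split=> // k.
by have := cP k; rewrite eval_point_coord.
Qed.

Variables (rho delta : R).
Hypotheses (rho_gt0 : 0 < rho) (rho_lt1 : rho < 1) (delta_gt0 : 0 < delta).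

(** Once the length of words is bounded, the coefficients range over a compact
    set, and the finite intersection property makes the choice of coefficients
    independent of the finite set of points. *)
Lemma majorant_exists : exists m (c : short_word (I := I) m -> R),
  [/\ forall w, 0 <= c w, \sum_w c w <= C + delta &
    forall t : I -> R, (forall i, `|t i| <= rho) ->
      `|reval 1 t p| <= \sum_w c w * word_val t (long w) + delta * \sum_i `|t i|].
Proof.
pose D := C + delta; have D0 : 0 < D by rewrite ltr_wpDl.
have [m Dm] : exists m, D * rho ^+ m <= delta.
  have /cvgrPdist_le/(_ (delta / D)) : (rho ^+ n) @[n --> \oo] --> (0 : R).
    by apply: cvg_expr; rewrite gtr0_norm.
  move=> /(_ (divr_gt0 delta_gt0 D0))[m _ /(_ m (leqnn m))] /=.
  rewrite sub0r normrN ger0_norm ?exprn_ge0 ?(ltW rho_gt0)// ler_pdivlMr// => h.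
  by exists m; rewrite mulrC.
exists m; pose W := short_word (I := I) m; pose n := #|W|.
pose K : set 'rV[R]_n := [set c | forall j, `[0, D]%classic (c ord0 j)].
have K_compact : compact K.
  by apply: (@rV_compact R n (fun=> `[0, D]%classic)) => j; exact: segment_compact.
pose lin (a : W -> R) (c : 'rV[R]_n) := \sum_w c 0 (enum_rank w) * a w.
have lin_cont a : continuous (lin a) by exact: rV_linear_continuous.
pose G (t : {ffun I -> R}) : set 'rV[R]_n := lin (fun=> 1) @^-1` [set r | r <= D] `&`
  lin (fun w => word_val t (long w)) @^-1`
    [set r | `|reval 1 t p| - delta * \sum_i `|t i| <= r].
pose Q : set {ffun I -> R} := [set t | forall i, `|t i| <= rho].
have [] : \bigcap_(t in Q) (K `&` G t) !=set0.
  move: K_compact; rewrite compact_In0; apply.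
    exists G => // t Qt; apply: closedI; (apply: closed_comp => [c _|];
      first exact: lin_cont); [exact: closed_le|exact: closed_ge].
  (* The origin is excluded from the finite set because the largest norm needs
     nonzero points; there the inequality reads 0 <= 0. *)
  move=> L LQ; pose S := [seq t <- finmap.enum_fset L | t != 0].
  pose pt (k : 'I_(size S)) : I -> R := nth 0 S k.
  have ptS (k : 'I_(size S)) : nth 0 S k \in S by exact: mem_nth.
  have ptQ k i : `|pt k i| <= rho.
    have := ptS k; rewrite mem_filter => /andP[_ /LQ]; rewrite inE; exact.
  have [] := @finite_majorant _ pt D.
  - by rewrite ltrDl.
  - by move=> k i; apply: le_trans (ptQ k i) (ltW rho_lt1).
  - move=> k; have := ptS k; rewrite mem_filter => /andP[k0 _].
    apply: contrapT => h; move/eqP: k0; apply; apply/ffunP => i; rewrite ffunE.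
    by apply: contrapT => /eqP ti; apply: h; exists i.
  move=> c [c0 cD cP]; pose c' : 'rV[R]_n := \row_j truncation c (enum_val j : W).
  have linE a : lin a c' = \sum_w truncation c w * a w.
    by apply: eq_bigr => w _; rewrite mxE enum_rankK.
  have c'0 w : 0 <= truncation c (w : W) by exact: truncation_ge0.
  have c'D : \sum_(w : W) truncation c w <= D.
    exact: le_trans (truncation_cost _ c0) cD.
  exists c' => t /= tL; split=> [j|].
    rewrite /= mxE in_itv/= c'0/=; apply: le_trans c'D.
    by rewrite (bigD1 (enum_val j))//= lerDl sumr_ge0.
  split; rewrite /= linE; first by under eq_bigr do rewrite mulr1.
  have Qt : forall i, `|t i| <= rho by have := LQ _ tL; rewrite inE.
  rewrite lerBlDr.
  have [->|t0] := eqVneq t 0.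
    rewrite (_ : (0 : {ffun I -> R}) = (fun=> 0) :> (I -> R)); last first.
      by apply/funext => i; rewrite ffunE.
    rewrite reval0 normr0 addr_ge0//.
      by apply: sumr_ge0 => w _; rewrite mulr_ge0// word_val_ge0.
    by rewrite mulr_ge0 ?sumr_ge0// ltW.
  apply: le_trans (truncation_val c0 (ltW rho_gt0) (ltW rho_lt1) Qt cD Dm).
  have tS : t \in S by rewrite mem_filter t0.
  have iS : (index t S < size S)%N by rewrite index_mem.
  by have := cP (Ordinal iS); rewrite /pt/= nth_index.
move=> c cG; exists (fun w => c 0 (enum_rank w)).
have Q0 : Q 0 by move=> i; rewrite ffunE normr0 ltW.
have [cK [cD _]] := cG _ Q0; split.
- by move=> w; have := cK (enum_rank w); rewrite /= in_itv/= => /andP[].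
- suff -> : \sum_w c 0 (enum_rank w) = lin (fun=> 1) c by [].
  by apply: eq_bigr => w _; rewrite mulr1.
- move=> t t_le; have Qt : Q (finfun t) by move=> i; rewrite ffunE.
  have [_ [_]] := cG _ Qt; rewrite /= lerBlDr.
  by rewrite (_ : (finfun t : I -> R) = t)//; apply/funext => i; rewrite ffunE.
Qed.

End MajorantExists.

Section NormEval.
Context {R : realType} {I : finType} {A : banachFAlgType R}.

Definition tabs (X : Type) (p : term R X) : term R X := TJoin p (TScale (- 1) p).

Lemma eval_tabs (X : Type) (V : vectorLatticeAlgType R) (b : X -> V) (p : term R X) :
  eval b (tabs p) = modulus (eval b p).
Proof. by rewrite /= scaleN1r. Qed.

Lemma reval_tabs (X : Type) w (t : X -> R) (p : term R X) :
  reval w t (tabs p) = `|reval w t p|.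
Proof. by rewrite /= mulN1r maxrN. Qed.

Definition tword (u : I * seq I) : term R I :=
  foldr (fun i q => TMul (tabs (TVar i)) q) (tabs (TVar u.1)) u.2.

Lemma reval_tword (t : I -> R) u : reval 1 t (tword u) = word_val t u.
Proof.
rewrite /word_val /tword; case: u => i v /=; elim: v => [|j v IHv].
  by rewrite big_nil mulr1 /= mulN1r maxrN.
by rewrite big_cons/= IHv mulN1r maxrN mul1r mulrCA.
Qed.

Lemma norm_eval_tword (s : I -> A) u : (forall i, `|s i| <= 1) ->
  `|eval s (tword u)| <= 1.
Proof.
move=> s1; rewrite /tword; case: u => i v /=; elim: v => [|j v IHv].
  by rewrite /= scaleN1r norm_modulus.
rewrite /= scaleN1r; apply: le_trans (ler_norm_vmul _ _) _.
by rewrite mulr_ile1// norm_modulus.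
Qed.

Variables (p : term R I) (C : R).
Hypothesis C_bound : forall (B : banachFAlgType R) (b : I -> B),
  semiprime B -> finite_dimensional B -> (forall i, `|b i| <= 1) ->
  `|eval b p| <= C.

(** The real majorant q of |p| on the cube transfers to A, where its norm is at
    most the sum of its coefficients because words in contractions are
    contractions. *)
Lemma norm_eval_le_lt1 (rho : R) (s : I -> A) : 0 < rho -> rho < 1 ->
  (forall i, `|s i| < rho) -> `|eval s p| <= C.
Proof.
move=> rho0 rho1 s_lt; apply/ler_addgt0Pr => eps eps0.
pose n1 : R := #|I|%:R + 1.
have n1_gt0 : 0 < n1 by rewrite ltr_wpDl.
have [m [c [c0 cD cP]]] := majorant_exists C_bound rho0 rho1 (divr_gt0 eps0 n1_gt0).
set delta := eps / n1 in cD cP.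
have delta0 : 0 < delta by exact: divr_gt0.
pose q : term R I := TAdd
  (tsum (enum (short_word (I := I) m)) (fun w => TScale (c w) (tword (long w))))
  (TScale delta (tsum (enum I) (fun i => tabs (TVar i)))).
have pq : vle (eval s (tabs p)) (eval s q).
  apply: (eval_le rho0) => // t t_le; rewrite reval_tabs.
  apply: le_trans (cP t t_le) _; rewrite [leRHS]/= !reval_sum !big_enum/=.
  rewrite le_eqVlt; apply/orP; left; apply/eqP; congr (_ + _ * _).
    by apply: eq_bigr => w _; rewrite reval_tword.
  by apply: eq_bigr => i _; rewrite mulN1r maxrN.
rewrite eval_tabs in pq; apply: le_trans (norm_le_of_modulus pq) _.
have s1 i : `|s i| <= 1 by exact/ltW/(lt_trans (s_lt i)).
rewrite [X in `|X|]/= !eval_sum !big_enum; apply: le_trans (ler_normD _ _) _.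
have h1 : `|\sum_w eval s (TScale (c w) (tword (long w)))| <= C + delta.
  apply: le_trans (ler_norm_sum _ _ _) _; apply: le_trans cD; apply: ler_sum => w _.
  by rewrite [X in `|X|]/= normrZ ger0_norm// ler_piMr// norm_eval_tword.
have h2 : `|delta *: \sum_(i : I) eval s (tabs (TVar i))| <= delta * #|I|%:R.
  rewrite normrZ gtr0_norm// ler_pM2l//; apply: le_trans (ler_norm_sum _ _ _) _.
  rewrite -sum1_card natr_sum; apply: ler_sum => i _.
  by rewrite eval_tabs norm_modulus; exact: s1.
apply: le_trans (lerD h1 h2) _; rewrite -addrA lerD2l.
by rewrite -{1}[delta]mulr1 -mulrDr addrC /delta divfK// gt_eqF.
Qed.

(** The elements (1 - e) s_i have norm less than 1 and tend to s_i, and the value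
    of a term is continuous in its variables. *)
Lemma norm_eval_le (s : I -> A) : (forall i, `|s i| <= 1) -> `|eval s p| <= C.
Proof.
move=> s1; apply/ler_addgt0Pr => eps eps0.
have [d d0 hd] := eval_close p s eps0.
pose e := Num.min d 2^-1; have e0 : 0 < e by rewrite lt_min d0 invr_gt0 ltr0n.
have [ed e2] : e <= d /\ e <= 2^-1 by rewrite !ge_min !lexx orbT.
pose s' i := (1 - e) *: s i.
have ss' i : i \in vars p -> `|s i - s' i| <= d.
  move=> _; rewrite /s' scalerBl scale1r subKr normrZ gtr0_norm//.
  by apply: le_trans ed; rewrite ler_piMr// ltW.
have := hd _ ss' => {}hd.
have s'_le : `|eval s' p| <= C.
  apply: (@norm_eval_le_lt1 (1 - e / 2)); [lra|lra|].
  move=> i; rewrite normrZ ger0_norm ?subr_ge0; last by lra.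
  apply: (@le_lt_trans _ _ (1 - e)); last by lra.
  by rewrite ler_piMr// subr_ge0; lra.
have := ler_normD (eval s p - eval s' p) (eval s' p); rewrite subrK; lra.
Qed.

End NormEval.

(** * Finite-rank contractive approximation in L_1 *)

Import HBSimple.

Section L1Approximation.
Context d (T : measurableType d) (R : realType).
Variable mu : {measure set T -> \bar R}.
Local Notation Lfun1 := (LfunType mu (@lexx _ _ 1%E)).
Implicit Types (f g : T -> R) (x : L1 mu).

Local Notation itg f := (mu.-integrable setT (EFin \o f)).

(** The class of an integrable function. Totality, with value 0 at the other
    functions, keeps proofs of integrability out of the terms. *)
Definition toL1 f : L1 mu := L1_pi (insubd (0 : Lfun1) f).

Lemma insubd_integrable f : itg f -> insubd (0 : Lfun1) f = f :> (T -> R).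
Proof. by move=> /Lfun1_integrable fL; exact: (insubdK (0 : Lfun1) fL). Qed.

Lemma itg_repr x : itg (L1_repr x).
Proof. exact/Lfun1_integrable/LfunP. Qed.

Lemma toL1_repr x : toL1 (L1_repr x) = x.
Proof. by rewrite /toL1 -[RHS]L1_reprK; congr L1_pi; exact: valKd. Qed.

Lemma itg_measurable f : itg f -> measurable_fun setT f.
Proof. by move=> /measurable_int/measurable_EFinP. Qed.

Lemma itgD f g : itg f -> itg g -> itg (fun t => f t + g t).
Proof. by move=> hf hg; apply: (integrableD _ hf hg). Qed.

Lemma itgZ (a : R) f : itg f -> itg (fun t => a * f t).
Proof. by move=> hf; apply: (integrableZl _ a hf). Qed.

Lemma itg0 : itg (fun=> 0). Proof. exact: integrable0. Qed.

Lemma itg_abs f : itg f -> itg (fun t => `|f t|).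
Proof. by move=> hf; apply: (integrable_abse hf). Qed.

Lemma itg_le f g : measurable_fun setT f -> (forall t, `|f t| <= `|g t|) ->
  itg g -> itg f.
Proof.
move=> mf fg; apply: le_integrable => //; first exact/measurable_EFinP.
by move=> t _; rewrite /= lee_fin.
Qed.

Lemma itg_sum (J : Type) (r : seq J) (F : J -> T -> R) :
  (forall j, itg (F j)) -> itg (fun t => \sum_(j <- r) F j t).
Proof.
move=> hF; elim: r => [|j r IHr].
  by rewrite (_ : (fun t => _) = fun=> 0);
    [exact: itg0|apply/funext => t; rewrite big_nil].
rewrite (_ : (fun t => _) = fun t => F j t + \sum_(i <- r) F i t).
  exact: itgD.
by apply/funext => t; rewrite big_cons.
Qed.

Lemma Rintegral_sum (J : Type) (r : seq J) (F : J -> T -> R) :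
  (forall j, itg (F j)) ->
  \int[mu]_t (\sum_(j <- r) F j t) = \sum_(j <- r) \int[mu]_t F j t.
Proof.
move=> hF; elim: r => [|j r IHr].
  by rewrite big_nil; under eq_Rintegral do rewrite big_nil;
    rewrite Rintegral_cst// mul0r.
rewrite big_cons -IHr -RintegralD//; last exact: itg_sum.
by apply: eq_Rintegral => t _; rewrite big_cons.
Qed.

Lemma toL1D f g : itg f -> itg g -> toL1 (fun t => f t + g t) = toL1 f + toL1 g.
Proof.
move=> hf hg; rewrite /toL1 -L1_piD; congr L1_pi; apply: val_inj => /=.
by rewrite (insubd_integrable (itgD hf hg)) !insubd_integrable.
Qed.

Lemma toL1Z (a : R) f : itg f -> toL1 (fun t => a * f t) = a *: toL1 f.
Proof.
move=> hf; rewrite /toL1 -[RHS]/(L1_scale _ _) L1_piZ; congr L1_pi.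
apply: val_inj => /=.
by rewrite (insubd_integrable (itgZ a hf)) insubd_integrable.
Qed.

Lemma toL10 : toL1 (fun=> 0) = 0.
Proof.
have := toL1Z 0 itg0; rewrite scale0r => <-; congr toL1.
by apply/funext => t; rewrite mul0r.
Qed.

Lemma toL1_sum (J : Type) (r : seq J) (F : J -> T -> R) :
  (forall j, itg (F j)) ->
  toL1 (fun t => \sum_(j <- r) F j t) = \sum_(j <- r) toL1 (F j).
Proof.
move=> hF; elim: r => [|j r IHr].
  by rewrite big_nil -toL10; congr toL1; apply/funext => t; rewrite big_nil.
rewrite big_cons -IHr -toL1D//; last exact: itg_sum.
by congr toL1; apply/funext => t; rewrite big_cons.
Qed.

Lemma norm_toL1 f : itg f -> `|toL1 f| = \int[mu]_t `|f t|.
Proof.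
move=> hf; rewrite [LHS]L1_norm_pi Lnorm1 insubd_integrable//.
Qed.

Definition pairing x g : R := \int[mu]_t (L1_repr x t * g t).

Lemma itg_mul f g : itg f -> measurable_fun setT g -> (forall t, `|g t| <= 1) ->
  itg (fun t => f t * g t).
Proof.
move=> hf mg g1; apply: (itg_le _ _ hf).
  by apply: measurable_funM => //; exact: itg_measurable.
by move=> t; rewrite normrM ler_piMr.
Qed.

Lemma pairingE f g : itg f -> measurable_fun setT g -> (forall t, `|g t| <= 1) ->
  pairing (toL1 f) g = \int[mu]_t (f t * g t).
Proof.
move=> hf mg g1; congr fine; apply: ae_eq_integral => //.
- exact: (measurable_int mu (itg_mul (itg_repr _) mg g1)).
- exact: (measurable_int mu (itg_mul hf mg g1)).
- apply: filterS (L1_piK (insubd (0 : Lfun1) f)) => t /= h _.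
  by rewrite h// insubd_integrable.
Qed.

Lemma pairing_linear g : measurable_fun setT g -> (forall t, `|g t| <= 1) ->
  forall (a : R) x y, pairing (a *: x + y) g = a * pairing x g + pairing y g.
Proof.
move=> mg g1 a x y; rewrite -[x]toL1_repr -[y]toL1_repr.
set f := L1_repr x; set h := L1_repr y.
have [hf hh] : itg f /\ itg h by split; exact: itg_repr.
rewrite -toL1Z// -toL1D ?itgZ// !pairingE ?itgD ?itgZ//.
rewrite -RintegralZl//; last exact: itg_mul.
rewrite -RintegralD//; [|apply: itgZ; exact: itg_mul|exact: itg_mul].
by apply: eq_Rintegral => t _; ring.
Qed.

(** The level set of the value 0, which may have infinite measure, is replaced
    by the empty set. *)
Lemma simple_dense x (eps : R) : 0 < eps ->
  exists (n : nat) (a : 'I_n -> R) (B : 'I_n -> set T),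
  [/\ forall j, measurable (B j), forall j, itg (\1_(B j) : T -> R) &
    `|x - \sum_j a j *: toL1 \1_(B j)| <= eps].
Proof.
move=> eps0.
have [g [hg _ gx]] := approximation_sfun_integrable measurableT (itg_repr x).
have [N gN] : exists N, \int[mu]_t `|L1_repr x t - g N t| <= eps.
  have /fine_fcvg/cvgrPdist_le/(_ _ eps0)[N _ /(_ N (leqnn N))] := gx.
  by rewrite /= sub0r normrN => h; exists N; exact: le_trans (ler_norm _) h.
pose s : seq R := finmap.enum_fset (fset_set (range (g N))).
pose A (i : 'I_(size s)) := if s`_i == 0 then set0 else g N @^-1` [set s`_i].
have mA i : measurable (A i) by rewrite /A; case: ifP.
have iA i : itg (\1_(A i) : T -> R).
  rewrite /A; have [_|si0] := eqVneq s`_i 0.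
    by rewrite indic0; exact: itg0.
  apply: (@itg_le _ (fun t => (s`_i)^-1 * g N t)); last exact: itgZ.
    exact: measurable_indic.
  move=> t; rewrite indicE.
  case: (boolP (t \in _)) => [/set_mem/= ->|_]; last by rewrite normr0.
  by rewrite mulVf.
exists (size s), (fun i => s`_i), A; split=> //.
have gE t : g N t = \sum_(i < size s) s`_i * \1_(A i) t.
  rewrite (fimfunEord (g N)) -/s; apply: eq_bigr => i _.
  by rewrite /A; have [->|_] := eqVneq s`_i 0; rewrite ?mul0r.
rewrite -[x]toL1_repr (_ : \sum_j _ = toL1 (g N)); last first.
  rewrite (_ : (g N : T -> R) = fun t => \sum_(i < size s) s`_i * \1_(A i) t);
    last exact/funext.
  by rewrite toL1_sum; [apply: eq_bigr => i _; rewrite toL1Z|move=> i; exact: itgZ].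
rewrite -scaleN1r -toL1Z// -toL1D//; [|exact: itg_repr|exact: itgZ].
rewrite norm_toL1; last by apply: itgD; [exact: itg_repr|exact: itgZ].
by under eq_Rintegral do rewrite mulN1r.
Qed.

Lemma common_simple_dense (s : seq (L1 mu)) (eps : R) : 0 < eps ->
  exists (J : finType) (B : J -> set T),
  [/\ forall j, measurable (B j), forall j, itg (\1_(B j) : T -> R) &
    forall x, x \in s -> exists a : J -> R,
      `|x - \sum_j a j *: toL1 \1_(B j)| <= eps].
Proof.
move=> eps0; elim: s => [|x s [J [B [mB iB hB]]]].
  by exists void, (fun=> set0); split => // -[].
have [n [a [C [mC iC xC]]]] := simple_dense x eps0.
exists (J + 'I_n)%type, (fun j => match j with inl j => B j | inr i => C i end).
split=> [[j|i]|[j|i]|y] //; rewrite inE => /predU1P[->|/hB[b yb]].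
  exists (fun j => match j with inl _ => 0 | inr i => a i end).
  by rewrite big_sumType/= big1 ?add0r// => j _; rewrite scale0r.
exists (fun j => match j with inl j => b j | inr _ => 0 end).
have z : \sum_(i < n) 0 *: toL1 \1_(C i) = 0 by apply: big1 => i _; rewrite scale0r.
by rewrite big_sumType/= z addr0.
Qed.

Section Atoms.
Variables (J : finType) (B : J -> set T).
Hypothesis mB : forall j, measurable (B j).
Hypothesis iB : forall j, itg (\1_(B j) : T -> R).

(** The atoms of the ring of sets generated by the B_j are indexed by the nonempty
    subsets of the index set. The empty subset, whose points are those outside
    all B_j, is given an empty atom, so that every atom has finite measure. *)
Definition trace (t : T) : {set J} := finset (fun j => t \in B j).
Definition atom (S : {set J}) : set T := [set t | trace t = S /\ S != finset.set0].

Lemma measurable_atom S : measurable (atom S).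
Proof.
have [->|S0] := eqVneq S finset.set0.
  by rewrite (_ : atom _ = set0)//; apply/seteqP; split=> t // -[_]; rewrite eqxx.
rewrite (_ : atom S =
    \bigcap_(j in [set: J]) (if j \in S then B j else ~` B j)); last first.
  apply/seteqP; split => t.
    by move=> [<- _] j _; rewrite inE; case: ifPn => [/set_mem|/negP h Bj] //;
      apply: h; exact: mem_set.
  move=> h; split=> //; apply/setP => j; rewrite inE.
  have := h j I; case: ifPn => jS Bj; first exact: mem_set.
  by apply/negbTE/negP => /set_mem.
apply: fin_bigcap_measurable => [|j _]; first exact: finite_finset.
by case: ifP => _; [|apply: measurableC].
Qed.

Definition atom_ind S : T -> R := \1_(atom S).

Lemma atom_indE S t : atom_ind S t = ((trace t == S) && (S != finset.set0))%:R.
Proof.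
rewrite /atom_ind indicE; congr (nat_of_bool _)%:R.
by apply/idP/idP => [/set_mem[-> ->]|/andP[/eqP tS S0]]; [rewrite eqxx|exact: mem_set].
Qed.

Lemma atom_ind_ge0 S t : 0 <= atom_ind S t.
Proof. by rewrite atom_indE. Qed.

Lemma atom_ind_le1 S t : `|atom_ind S t| <= 1.
Proof. by rewrite atom_indE; case: (_ && _); rewrite ?normr1 ?normr0. Qed.

Lemma measurable_atom_ind S : measurable_fun setT (atom_ind S).
Proof. exact: measurable_indic (measurable_atom S). Qed.

Lemma atom_ind_sum t : \sum_S atom_ind S t <= 1.
Proof.
rewrite (bigD1 (trace t))//= [X in _ + X]big1 ?addr0.
  by apply: le_trans (atom_ind_le1 (trace t) t); exact: ler_norm.
by move=> S /negbTE; rewrite atom_indE eq_sym => ->.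
Qed.

Lemma ind_mul_atom j S t : \1_(B j) t * atom_ind S t = (j \in S)%:R * atom_ind S t.
Proof.
rewrite atom_indE indicE; have [<-|_] := eqVneq (trace t) S; last by rewrite !mulr0.
by rewrite inE.
Qed.

Lemma ind_sum_atom j t : \1_(B j) t = \sum_(S : {set J}) (j \in S)%:R * atom_ind S t.
Proof.
rewrite (bigD1 (trace t))//= big1 => [|S /negbTE]; last first.
  by rewrite atom_indE eq_sym => ->; rewrite mulr0.
rewrite addr0 atom_indE eqxx/= inE indicE; case: (boolP (t \in B j)) => h.
  rewrite mul1r; suff -> : trace t != finset.set0 by [].
  by apply/set0Pn; exists j; rewrite inE.
by rewrite mul0r.
Qed.

Lemma itg_atom S : itg (atom_ind S).
Proof.
have [->|/set0Pn[j jS]] := eqVneq S finset.set0.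
  rewrite (_ : atom_ind _ = fun=> 0); first exact: itg0.
  by apply/funext => t; rewrite atom_indE eqxx andbF.
apply: (itg_le (measurable_atom_ind S) _ (iB j)) => t.
have := ind_mul_atom j S t; rewrite jS mul1r => <-.
by rewrite normrM ler_piMr// atom_ind_le1.
Qed.

(** Averaging over an atom and putting the average back. For a null atom the
    inverse of the mass is 0, and so is the class of the indicator. *)
Definition atom_mass S : R := \int[mu]_t atom_ind S t.
Definition atom_fun S (x : L1 mu) : R := pairing x (atom_ind S).
Definition atom_vec S : L1 mu := (atom_mass S)^-1 *: toL1 (atom_ind S).

Lemma norm_toL1_atom S : `|toL1 (atom_ind S)| = atom_mass S.
Proof.
rewrite norm_toL1; last exact: itg_atom.
by apply: eq_Rintegral => t _; rewrite ger0_norm ?atom_ind_ge0.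
Qed.

Lemma norm_atom_vec S : `|atom_vec S| <= 1.
Proof.
rewrite /atom_vec normrZ norm_toL1_atom -norm_toL1_atom normfV normr_id.
by have [->|h] := eqVneq `|toL1 (atom_ind S)| 0; rewrite ?mulr0// mulVf.
Qed.

Lemma atom_fun_linear S (a : R) x y :
  atom_fun S (a *: x + y) = a * atom_fun S x + atom_fun S y.
Proof. exact: pairing_linear (measurable_atom_ind S) (atom_ind_le1 S) a x y. Qed.

Lemma atom_fun_sum x : \sum_S `|atom_fun S x| <= `|x|.
Proof.
rewrite -[x]toL1_repr; set f := L1_repr x; have hf : itg f by exact: itg_repr.
have hfS S : itg (fun t => f t * atom_ind S t).
  exact: itg_mul hf (measurable_atom_ind S) (atom_ind_le1 S).
apply: (@le_trans _ _ (\sum_S \int[mu]_t `|f t * atom_ind S t|)).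
  apply: ler_sum => S _; rewrite /atom_fun pairingE//.
  - exact: le_normr_Rintegral.
  - exact: measurable_atom_ind.
  - exact: atom_ind_le1.
rewrite -Rintegral_sum; last by move=> S; exact: itg_abs.
rewrite norm_toL1//; apply: le_Rintegral => //.
- by apply: itg_sum => S; exact: itg_abs.
- exact: itg_abs.
- move=> t _; under eq_bigr do rewrite normrM (ger0_norm (atom_ind_ge0 _ _)).
  by rewrite -mulr_sumr ler_piMr// atom_ind_sum.
Qed.

Definition atom_proj (x : L1 mu) : L1 mu := \sum_S atom_fun S x *: atom_vec S.

Lemma atom_proj_linear (a : R) x y :
  atom_proj (a *: x + y) = a *: atom_proj x + atom_proj y.
Proof.
rewrite /atom_proj scaler_sumr -big_split/=; apply: eq_bigr => S _.
by rewrite atom_fun_linear scalerDl scalerA.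
Qed.

Lemma atom_proj_ind j : atom_proj (toL1 \1_(B j)) = toL1 \1_(B j).
Proof.
transitivity (\sum_(S : {set J}) (j \in S)%:R *: toL1 (atom_ind S)).
  apply: eq_bigr => S _.
  rewrite /atom_fun pairingE; last 3 first.
  - exact: iB.
  - exact: measurable_atom_ind.
  - exact: atom_ind_le1.
  under eq_Rintegral do rewrite ind_mul_atom.
  rewrite RintegralZl//; last exact: itg_atom.
  rewrite -/(atom_mass S) /atom_vec scalerA -mulrA.
  have [m0|m0] := eqVneq (atom_mass S) 0; last by rewrite mulfV// mulr1.
  by have := norm_toL1_atom S; rewrite m0 => /normr0_eq0 ->; rewrite !scaler0.
have -> : \1_(B j) = (fun t => \sum_(S : {set J}) (j \in S)%:R * atom_ind S t).
  by apply/funext => t; exact: ind_sum_atom.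
rewrite toL1_sum; last by move=> S; apply: itgZ; exact: itg_atom.
by apply: eq_bigr => S _; rewrite toL1Z//; exact: itg_atom.
Qed.

Lemma norm_atom_proj x : `|atom_proj x| <= `|x|.
Proof.
apply: le_trans (ler_norm_sum _ _ _) _; apply: le_trans (atom_fun_sum x).
by apply: ler_sum => S _; rewrite normrZ ler_piMr// norm_atom_vec.
Qed.

End Atoms.

(** The conditional expectation onto the atoms of finitely many sets of finite
    measure factors through l_1^n contractively, and it fixes the simple
    functions that approximate the given vectors. *)
Lemma L1_finite_rank (s : seq (L1 mu)) (eps : R) : 0 < eps ->
  exists (I : finType) (P : I -> L1 mu -> R) (u : I -> L1 mu),
  [/\ forall i (a : R) x y, P i (a *: x + y) = a * P i x + P i y,
    forall x, \sum_i `|P i x| <= `|x|, forall i, `|u i| <= 1 &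
    forall x, x \in s -> `|x - \sum_i P i x *: u i| <= eps].
Proof.
move=> eps0; have e2 : 0 < eps / 2 by rewrite divr_gt0.
have [J [B [mB iB hB]]] := common_simple_dense s e2.
exists {set J}, (atom_fun B), (atom_vec B); split.
- exact: atom_fun_linear.
- exact: atom_fun_sum.
- exact: norm_atom_vec.
move=> x /hB[a xa]; rewrite -/(atom_proj B x).
set y := \sum_j _ in xa.
have yE : atom_proj B y = y.
  rewrite /y; elim/big_rec: _ => [|j z _ zE].
    have := atom_proj_linear mB 1 0 0; rewrite !scale1r addr0 => h.
    by apply: (addrI (atom_proj B 0)); rewrite -h addr0.
  by rewrite atom_proj_linear// atom_proj_ind// zE.
have -> : x - atom_proj B x = (x - y) - atom_proj B (x - y).
  have -> : atom_proj B (x - y) = atom_proj B x - y.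
    by rewrite [x - y]addrC -scaleN1r atom_proj_linear// yE scaleN1r addrC.
  by rewrite opprB addrA subrK.
apply: le_trans (ler_normB _ _) _.
have := norm_atom_proj mB iB (x - y); lra.
Qed.

End L1Approximation.

(** * Terms are dense in the free Banach f-algebra *)

Section SubBanachFAlgebra.
Context {R : realType} {A : banachFAlgType R}.
Variables (S : set A) (S_subfalg : subfalg_closed S).
Hypothesis S_closed : forall x, closure S x -> S x.

Definition banach_subfalg of (forall x, closure S x -> S x) := subfalg S_subfalg.
Local Notation B := (banach_subfalg S_closed).

HB.instance Definition _ := FAlgebra.on B.

Let sub_norm (x : B) : R := `|val x|.

Fact sub_normD (x y : B) : sub_norm (x + y) <= sub_norm x + sub_norm y.
Proof. exact: ler_normD. Qed.
Fact sub_normZ (a : R) (x : B) : sub_norm (a *: x) = `|a| * sub_norm x.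
Proof. exact: normrZ. Qed.
Fact sub_norm_eq0 (x : B) : sub_norm x = 0 -> x = 0.
Proof. by move=> /normr0_eq0 x0; apply: val_inj. Qed.

HB.instance Definition _ := Lmodule_isNormed.Build R B
  sub_normD sub_normZ sub_norm_eq0.

Fact sub_complete (F : set_system B) : ProperFilter F -> cauchy F -> cvg F.
Proof.
apply: (@complete_embedding R B A val 1 ltr01) => [|x y|x y|w].
- exact: cauchy_cvg.
- exact: lexx.
- by rewrite mul1r.
- move=> wS; have Sw : S w.
    by apply: S_closed; apply: closure_subset wS => _ [x _ <-]; exact: subfalgP.
  by exists (subfalg_mk S_subfalg Sw).
Qed.

HB.instance Definition _ := Uniform_isComplete.Build B sub_complete.

Fact sub_norm_modulus (x y : B) : vle (modulus x) (modulus y) -> `|x| <= `|y|.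
Proof. exact: (@ler_norm_modulus _ _ (val x) (val y)). Qed.

Fact sub_norm_mul (x y : B) : `|vmul x y| <= `|x| * `|y|.
Proof. exact: (@ler_norm_vmul _ _ (val x) (val y)). Qed.

HB.instance Definition _ :=
  isBanachFAlgebra.Build R B sub_norm_modulus sub_norm_mul.

Lemma norm_banach_subfalg (x : B) : `|x| = `|val x|. Proof. by []. Qed.

End SubBanachFAlgebra.

Lemma contractiveP (R : realType) (E F : normedModType R) (T : E -> F) :
  (forall x, `|T x| <= `|x|) -> contractive T.
Proof.
move=> T1; apply: ge_ereal_sup => _ [x /= x1 <-].
by rewrite lee_fin (le_trans (T1 x)).
Qed.

Lemma le_opnorm1 (R : realType) (E F : normedModType R) (T : E -> F) :
  linear T -> (opnorm T <= 1)%E -> forall x, `|T x| <= `|x|.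
Proof.
move=> linT T1 x.
have T0 : T 0 = 0.
  have := linT 1 0 0; rewrite !scale1r addr0 => h.
  by apply: (addrI (T 0)); rewrite -h addr0.
have [->|x0] := eqVneq x 0; first by rewrite T0 !normr0.
have nx : 0 < `|x| by rewrite normr_gt0.
have : (`|T (`|x|^-1 *: x)|%:E <= 1)%E.
  apply: le_trans T1; apply: ereal_sup_ubound; exists (`|x|^-1 *: x) => //=.
  by rewrite normrZ normfV normr_id mulVf// gt_eqF.
have -> : T (`|x|^-1 *: x) = `|x|^-1 *: T x.
  by have := linT `|x|^-1 x 0; rewrite T0 !addr0.
by rewrite lee_fin normrZ normfV normr_id ler_pdivrMl// mulr1.
Qed.

Lemma homB (R : realType) (A B : vectorLatticeAlgType R) (S : A -> B) :
  lattice_algebra_hom S -> {morph S : x y / x - y}.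
Proof.
by move=> [lin _ _ _] x y; have := lin (- 1) y x; rewrite !scaleN1r ![- _ + _]addrC.
Qed.

Section FreeBanachFAlgebra.
Context {R : realType} {E : normedModType R} {F : banachFAlgType R}.
Variable eta : {linear E -> F}.
Hypothesis eta_free : is_free_banach_falgebra eta.

Lemma eta_norm x : `|eta x| = `|x|. Proof. by have [] := eta_free. Qed.

Lemma hat_extension (A : banachFAlgType R) (T : {linear E -> A}) :
  contractive T -> is_extension eta T (hat eta T).
Proof.
move=> hT; have [_ /(_ A T hT)[[S [hS _]] _]] := eta_free.
by rewrite /hat; apply: (@xgetPex _ (fun=> 0) [set S | is_extension eta T S]); exists S.
Qed.

Lemma norm_hat_le (A : banachFAlgType R) (T : {linear E -> A}) f :
  contractive T -> `|hat eta T f| <= `|f|.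
Proof.
move=> hT; have hS := hat_extension hT; have [[lin _ _ _] _] := hS.
apply: le_opnorm1 => //; have [_ /(_ A T hT)[_ h]] := eta_free.
by rewrite h.
Qed.

Let S : set F := [set x | forall eps, 0 < eps -> exists p, `|x - eval eta p| <= eps].

Let S_subfalg : subfalg_closed S.
Proof.
have half (e : R) : 0 < e -> 0 < e / 2 by move=> e0; rewrite divr_gt0.
split => [eps eps0|x y hx hy eps eps0|a x hx eps eps0|x y hx hy eps eps0
  |x y hx hy eps eps0].
- by exists TZero; rewrite subrr normr0 ltW.
- have [[p xp] [q yq]] := (hx _ (half _ eps0), hy _ (half _ eps0)).
  exists (TAdd p q); rewrite /= opprD addrACA.
  by apply: le_trans (ler_normD _ _) _; lra.
- have a0 : 0 < `|a| + 1 by rewrite ltr_wpDl.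
  have [p xp] := hx _ (divr_gt0 eps0 a0); exists (TScale a p).
  move: xp; rewrite /= -scalerBr normrZ ler_pdivlMr//; apply: le_trans.
  by rewrite mulrDr mulr1 mulrC lerDl.
- have [[p xp] [q yq]] := (hx _ (half _ eps0), hy _ (half _ eps0)).
  exists (TJoin p q); apply: le_trans (norm_vjoinB _ _ _ _) _; lra.
- pose M := `|x| + `|y| + 1.
  have M0 : 0 < M by rewrite ltr_wpDl// addr_ge0.
  have e0 : 0 < Num.min 1 (eps / (2 * M)).
    by rewrite lt_min ltr01 divr_gt0// mulr_gt0.
  have [[p + ] [q +]] := (hx _ e0, hy _ e0).
  rewrite !le_min => /andP[xp1 xp] /andP[yq1 yq].
  exists (TMul p q); apply: le_trans (norm_vmulB _ _ _ _) _.
  have pM : `|eval eta p| <= M.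
    have := ler_normB x (x - eval eta p); rewrite subKr => h.
    by apply: le_trans h _; rewrite /M -addrA lerD2l ler_wpDl.
  have yM : `|y| <= M by rewrite /M -addrA addrCA lerDl addr_ge0.
  apply: (@le_trans _ _ (eps / (2 * M) * M + M * (eps / (2 * M)))).
    by rewrite lerD// ler_pM.
  rewrite le_eqVlt; apply/orP; left; apply/eqP; field.
  by rewrite gt_eqF.
Qed.

Let S_closed x : closure S x -> S x.
Proof.
move=> Sx eps eps0; have e0 : 0 < eps / 2 by rewrite divr_gt0.
have [y [hy]] := Sx _ (nbhsx_ballx x _ e0).
rewrite -ball_normE/= => xy; have [p yp] := hy _ e0; exists p.
rewrite -(subrK y x) -addrA; apply: le_trans (ler_normD _ _) _; lra.
Qed.

(** The closed sub-f-algebra generated by the range of eta is a competitor in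
    the universal property, and composing the resulting map with the inclusion
    gives an extension of eta, which has to be the identity. *)
Lemma terms_dense f (eps : R) : 0 < eps -> exists p, `|f - eval eta p| <= eps.
Proof.
suff : S f by exact.
pose B := banach_subfalg S_subfalg S_closed.
have S_eta x : S (eta x).
  by move=> e e0; exists (TVar x); rewrite /= subrr normr0 ltW.
pose j x : B := subfalg_mk S_subfalg (S_eta x).
have j_linear : linear j by move=> a x y; apply: val_inj; rewrite /= linearP.
pose jl : {linear E -> B} := HB.pack j (GRing.isLinear.Build _ _ _ _ _ j_linear).
have j_contr : contractive jl.
  by apply: contractiveP => x; rewrite norm_banach_subfalg /= eta_norm.
have [[lin hI hU hM] hj] := hat_extension j_contr.
have [_ /(_ F eta)[]] := eta_free.
  by apply: contractiveP => x; rewrite eta_norm.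
move=> [S0 [_ S0_uniq]] _.
have id_ext : is_extension eta eta id by split.
have val_ext : is_extension eta eta (val \o hat eta jl).
  split; [split|].
  - by move=> a x y /=; rewrite lin.
  - by move=> x y /=; rewrite hI.
  - by move=> x y /=; rewrite hU.
  - by move=> x y /=; rewrite hM.
  - by apply/funext => x /=; have := congr1 (fun g => val (g x)) hj.
have := S0_uniq _ val_ext; rewrite (S0_uniq _ id_ext) => /(congr1 (@^~ f)) /= ->.
exact: subfalgP.
Qed.

End FreeBanachFAlgebra.

(** * The norm of the free Banach f-algebra of L_1 *)

Theorem corollary4p34 (R : realType) (d : measure_display)
    (T : measurableType d) (mu : {measure set T -> \bar R})
    (F : banachFAlgType R) (eta : {linear L1 mu -> F}) :
  is_free_banach_falgebra eta -> forall f : F, `|f| = tau eta f.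
Proof.
move=> eta_free f.
pose bound := [set t : R | 0 <= t /\
    forall A : banachFAlgType R, semiprime A -> finite_dimensional A ->
    forall T : {linear L1 mu -> A}, contractive T -> `|hat eta T f| <= t].
have bound_f : bound `|f|.
  by split=> // A _ _ S hS; exact: norm_hat_le.
apply/eqP; rewrite eq_le; apply/andP; split; last first.
  by apply: ge_inf => //; exists 0 => t [].
apply: lb_le_inf; first by exists `|f|.
move=> t [t0 ft]; apply/ler_addgt0Pr => eps eps0.
have e0 : 0 < eps / 3 by rewrite divr_gt0.
have [p fp] := terms_dense eta_free f e0.
have [delta delta0 pdelta] := eval_close p eta e0.
have [I [P [u [P_lin P_sum u1 uP]]]] := L1_finite_rank (vars p) delta0.
(* Replace eta by its composition with the finite-rank contraction
   x |-> \sum_i P i x *: u i; this turns p into a term in the finitely many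
   contractive variables eta (u i). *)
pose g x : term R I := tsum (enum I) (fun i => TScale (P i x) (TVar i)).
have evalg (V : vectorLatticeAlgType R) (b : I -> V) x :
    eval b (g x) = \sum_i P i x *: b i by rewrite eval_sum big_enum.
have close : `|eval eta p - eval (eta \o u) (tsubst g p)| <= eps / 3.
  rewrite eval_subst; apply: pdelta => x xp; rewrite evalg.
  have -> : \sum_i P i x *: (eta \o u) i = eta (\sum_i P i x *: u i).
    by rewrite linear_sum; apply: eq_bigr => i _; rewrite linearZ.
  by rewrite -linearB eta_norm// uP.
have le_t : `|eval (eta \o u) (tsubst g p)| <= t + eps / 3.
  apply: norm_eval_le => [B b B_sp B_fd b1|i]; last by rewrite /= eta_norm.
  (* Conversely, contractions b_i in B define a contractive operator on L_1, whose
     extension to F maps the term p in the eta x to the given term in the b_i. *)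
  pose S x : B := \sum_i P i x *: b i.
  have S_lin : linear S.
    move=> a x y; rewrite /S scaler_sumr -big_split; apply: eq_bigr => i _.
    by rewrite P_lin scalerDl scalerA.
  pose Sl : {linear L1 mu -> B} := HB.pack S (GRing.isLinear.Build _ _ _ _ _ S_lin).
  have S_contr : contractive Sl.
    apply: contractiveP => x; apply: le_trans (P_sum x).
    apply: le_trans (ler_norm_sum _ _ _) _; apply: ler_sum => i _.
    by rewrite normrZ ler_piMr.
  have [S_hom S_ext] := hat_extension eta_free S_contr.
  have -> : eval b (tsubst g p) = hat eta Sl (eval eta p).
    rewrite (hom_eval _ _ S_hom) S_ext eval_subst; apply: eq_eval => x.
    exact: evalg.
  rewrite -[eval eta p](subKr f) (homB S_hom).
  apply: le_trans (ler_normB _ _) _; apply: lerD; first exact: ft.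
  exact: le_trans (norm_hat_le eta_free _ S_contr) fp.
have := ler_normD (f - eval eta p) (eval eta p); rewrite subrK.
have := ler_normD (eval eta p - eval (eta \o u) (tsubst g p))
  (eval (eta \o u) (tsubst g p)); rewrite subrK.
lra.
Qed.
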